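(* Let $K$ be a Hilbert space, let $D\in\mathbb{B}(K)$ be self-adjoint and let $f=(f_{ij})_{1\le i,j\le2}\in M_2\big(C(\sigma(D))\big)$. Then $$\overline{W\big(f(D)\big)}=\overline{\operatorname{conv}\Big(\bigcup_{t\in\sigma(D)}W(f_t)\Big)},$$ where $f(D)=\begin{pmatrix}f_{11}(D)&f_{12}(D)\\ f_{21}(D)&f_{22}(D)\end{pmatrix}\in\mathbb{B}(K\oplus K)$ is defined by continuous functional calculus and $f_t=\begin{pmatrix}f_{11}(t)&f_{12}(t)\\ f_{21}(t)&f_{22}(t)\end{pmatrix}\in M_2(\mathbb{C})$ for $t\in\sigma(D)$.
   Context: $K$ is a non-zero complex Hilbert space; $\sigma(D)$ is the spectrum of $D$ and $C(\sigma(D))$ the complex-valued continuous functions on it. For a bounded operator $T$ on a Hilbert space $H$ (including a matrix in $M_2(\mathbb{C})$ acting on $\mathbb{C}^2$), the numerical range is $W(T)=\{\langle Tx,x\rangle:x\in H,\ \|x\|=1\}$. $\operatorname{conv}(E)$ and $\overline{E}$ denote the convex hull and closure of $E\subseteq\mathbb{C}$. *)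

(* Defs.v *)
From HB Require Import structures.
From mathcomp Require Import all_boot all_order all_algebra.
From mathcomp Require Import complex.
From mathcomp Require Import all_classical all_reals all_analysis.

Set Implicit Arguments.
Unset Strict Implicit.
Unset Printing Implicit Defensive.

Import Order.TTheory GRing.Theory Num.Theory.
Import numFieldNormedType.Exports.

Local Open Scope classical_set_scope.
Local Open Scope ring_scope.

(* The usual topology of the complex numbers: [numFieldNormedType.Exports]
   equips only abstract fields with it, not the concrete type [R[i]]. *)
HB.instance Definition _ (R : realType) := NormedModule.copy R[i] R[i]^o.

Section NumericalRange.
Variables (R : realType) (V : Type) (ip : V -> V -> R[i]).

Definition ipnorm (x : V) : R[i] := sqrtC (ip x x).

Definition numrange (T : V -> V) : set R[i] :=
  [set z | exists2 x, ipnorm x = 1 & z = ip (T x) x].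

End NumericalRange.

(* [convex_set] takes its coefficients in the interval [0, 1] of [R[i]]; since
   z <= w in [R[i]] means that w - z is a nonnegative real, this is the real
   unit interval. *)
Definition conv_hull (R : realType) (E : set R[i]) : set R[i] :=
  smallest (@convex_set _ R[i]^o) E.

Section Operators.
Variables (R : realType) (K : completeNormedModType R[i]).
Variable ip : {dot K for Num.conj}.

(* Together with the completeness of [K], this makes [K] a Hilbert space; the
   inner product is linear in its first argument. *)
Definition hilbert_norm := forall x : K, `|x| = ipnorm ip x.

Definition bounded_operator (T : K -> K) : Prop :=
  linear T /\ exists M : R[i], forall x, `|T x| <= M * `|x|.

Definition adjoint_of (T S : K -> K) : Prop :=
  forall x y, ip (T x) y = ip x (S y).

Definition self_adjoint (T : K -> K) : Prop := adjoint_of T T.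

Definition invertible_operator (T : K -> K) : Prop :=
  exists S, [/\ bounded_operator S, cancel T S & cancel S T].

Definition spectrum (D : K -> K) : set R[i] :=
  [set z | ~ invertible_operator (fun x => D x - z *: x)].

Local Notation C_spec D := (continuousType (spectrum D) R[i]).

(* Unital *-homomorphisms from C(spectrum D) to B(K) sending the inclusion of
   the spectrum in the complex plane to D; for a self-adjoint D there is exactly
   one. The operations of C(spectrum D) are the pointwise ones; the library does
   not define them on [continuousType], so each axiom quantifies over the
   function h that is equal to the pointwise result. *)
Record is_functional_calculus (D : K -> K) (Phi : C_spec D -> K -> K) : Prop := {
  fc_bounded : forall f, bounded_operator (Phi f);
  fc_add : forall f g h : C_spec D, (forall t, h t = f t + g t) ->
    forall x, Phi h x = Phi f x + Phi g x;
  fc_scale : forall (a : R[i]) (f h : C_spec D), (forall t, h t = a * f t) ->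
    forall x, Phi h x = a *: Phi f x;
  fc_mul : forall f g h : C_spec D, (forall t, h t = f t * g t) ->
    forall x, Phi h x = Phi f (Phi g x);
  fc_conj : forall f h : C_spec D, (forall t, h t = (f t)^*) ->
    adjoint_of (Phi f) (Phi h);
  fc_one : forall h : C_spec D, (forall t, h t = 1) ->
    forall x, Phi h x = x;
  fc_id : forall h : C_spec D, (forall t, h t = set_val t) ->
    forall x, Phi h x = D x }.

(* g(D), for g continuous on the spectrum of D. *)
Definition cfc (D : K -> K) : C_spec D -> K -> K :=
  xget (fun _ _ => 0) [set Phi | is_functional_calculus Phi].

(* Inner product of the Hilbert direct sum of two copies of K; the norm that the
   library puts on [K * K] is the maximum norm and is not used. *)
Definition dsum_ip (u v : K * K) : R[i] := ip u.1 v.1 + ip u.2 v.2.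

Definition block_operator (A : 'M[K -> K]_2) (u : K * K) : K * K :=
  (A 0 0 u.1 + A 0 1 u.2, A 1 0 u.1 + A 1 1 u.2).

(* f(D), acting on the direct sum of two copies of K. *)
Definition mx_cfc (D : K -> K) (f : 'M[C_spec D]_2) : K * K -> K * K :=
  block_operator (map_mx (@cfc D) f).

End Operators.

Definition cvec_ip (R : realType) (n : nat) (x y : 'cV[R[i]]_n) : R[i] :=
  \sum_i x i 0 * (y i 0)^*.

(* The numerical range of a matrix acting on column vectors. *)
Definition mx_numrange (R : realType) (n : nat) (A : 'M[R[i]]_n) : set R[i] :=
  numrange (@cvec_ip R n) (fun x => A *m x).

(* The matrix f_t of values at t. *)
Definition mx_at (R : realType) (E : set R[i])
    (f : 'M[continuousType E R[i]]_2) (t : E) : 'M[R[i]]_2 :=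
  map_mx (fun g => (g : continuousType E R[i]) t) f.

(* Main.v *)
(* Proof. Continuous functional calculi are built from polynomials: a real
   polynomial p >= 0 on the spectrum of D gives p(D) >= 0, because the infimum m
   of the numerical range of p(D) is a spectral value of p(D), so that p - m,
   factored over C, has a root in the spectrum of D; hence |p(D)| <= sup |p|, and
   polynomials are dense.

   For the inclusion from left to right, a partition of unity (phi_k) replaces f
   by sum_k phi_k f(t_k); then <f(D) u, u> is close to
   sum_k tr (f(t_k) G_k) with G_k = (<phi_k(D) u_j, u_i>) positive semidefinite
   and sum_k tr G_k = 1, which is a convex combination of elements of the
   W(f(t_k)). Conversely, <f_t v, v> is the limit of <f(D) u, u> for
   u = (v_0 x, v_1 x) with x an approximate eigenvector of D at t, and W(f(D)) is
   convex by the Toeplitz-Hausdorff theorem. *)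

Require Import Defs.
From mathcomp Require Import all_boot all_order all_algebra.
From mathcomp Require Import complex.
From mathcomp Require Import ring lra.
From mathcomp Require Import all_classical all_reals all_analysis.
Set Implicit Arguments.
Unset Strict Implicit.
Unset Printing Implicit Defensive.
Import Order.TTheory GRing.Theory Num.Theory.
Import numFieldNormedType.Exports.
Local Open Scope classical_set_scope.
Local Open Scope ring_scope.
Local Notation "x %:C" := (real_complex _ x) : ring_scope.

(** * Real-valued norms and the topology of the complex numbers *)

Section RealNorm.
Variable R : realType.

(** [cfc] is an [xget], hence the zero map unless a calculus exists: existence is part of the
    theorem, and from [cfcP] on only the axioms of [is_functional_calculus] describe [cfc]. The
    tents phi_k serve twice. Being combinations of functions |s - a|, they reduce polynomial density
    to approximating the absolute value; and they are the partition of unity of the final estimate.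
    The matrices G_k are positive because phi_k has a continuous square root: G_k is the Gram matrix
    of two vectors, a sum of two rank-one matrices, and on the rank-one matrix of a vector y the
    trace form of A is |y|^2 times a point of W(A). These weights may vanish one by one, so the
    convex combination is carried out as addition in the cone over the hull, and only the total
    weight is normalized to 1. For the converse a sup bound cannot see that x is concentrated near
    t. The majorant a + b (s - t)^2 of |g(s) - g(t)|^2 can: it bounds |g(D) x - g(t) x|^2 by a |x|^2
    + b |D x - t x|^2. *)

Definition rnorm (V : normedZmodType R[i]) (x : V) : R := complex.Re `|x|.

Section NormedZmod.
Variable V : normedZmodType R[i].
Implicit Types x y : V.

(** Norms live in [R[i]], whose order is partial; this is the passage to [R], where the order is
    total and [lra] and [nra] apply. *)
Lemma rnormE x : `|x| = (rnorm x)%:C.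
Proof. by rewrite /rnorm RRe_real// ger0_real. Qed.

Lemma rnorm_ge0 x : 0 <= rnorm x.
Proof. by rewrite -ler0c -rnormE. Qed.

Lemma rnorm0 : rnorm (0 : V) = 0.
Proof. by rewrite /rnorm normr0. Qed.

Lemma rnorm_eq0 x : (rnorm x == 0) = (x == 0).
Proof. by rewrite -(normr_eq0 x) rnormE; apply/eqP/eqP => [->//|/complexI]. Qed.

Lemma rnorm_gt0 x : (0 < rnorm x) = (x != 0).
Proof. by rewrite lt_def rnorm_eq0 rnorm_ge0 andbT. Qed.

Lemma rnormN x : rnorm (- x) = rnorm x.
Proof. by rewrite /rnorm normrN. Qed.

Lemma rdistC x y : rnorm (x - y) = rnorm (y - x).
Proof. by rewrite -rnormN opprB. Qed.

Lemma rnormD x y : rnorm (x + y) <= rnorm x + rnorm y.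
Proof. by rewrite -lecR rmorphD/= -!rnormE ler_normD. Qed.

Lemma rdistD y x z : rnorm (x - z) <= rnorm (x - y) + rnorm (y - z).
Proof. by apply: le_trans (rnormD _ _); rewrite addrA subrK. Qed.

Lemma rnorm_sum (I : Type) (r : seq I) (P : pred I) (F : I -> V) :
  rnorm (\sum_(i <- r | P i) F i) <= \sum_(i <- r | P i) rnorm (F i).
Proof.
elim/big_rec2: _ => [|i a b _ h]; first by rewrite rnorm0.
by apply: le_trans (rnormD _ _) _; rewrite lerD2l.
Qed.

End NormedZmod.

Lemma rnormZ (V : normedModType R[i]) (a : R[i]) (x : V) :
  rnorm (a *: x) = rnorm a * rnorm x.
Proof. by apply: complexI; rewrite rmorphM/= -!rnormE normrZ. Qed.

Lemma rnormM (a b : R[i]) : rnorm (a * b) = rnorm a * rnorm b.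
Proof. by apply: complexI; rewrite rmorphM/= -!rnormE normrM. Qed.

Lemma rnorm_real (a : R) : rnorm a%:C = `|a|.
Proof. by rewrite /rnorm normc_def/= expr0n/= addr0 sqrtr_sqr. Qed.

Lemma rnorm1 : rnorm (1 : R[i]) = 1.
Proof. by rewrite (rnorm_real 1) normr1. Qed.

Lemma rnorm_conj (a : R[i]) : rnorm a^* = rnorm a.
Proof. by rewrite /rnorm norm_conjC. Qed.

Lemma mul_conj_rnorm (a : R[i]) : a * a^* = (rnorm a ^+ 2)%:C.
Proof. by rewrite rmorphXn/= -rnormE normCK. Qed.

Lemma nbhs_rnormP (V : normedModType R[i]) (x : V) (A : set V) :
  nbhs x A <-> exists2 e : R, 0 < e & forall y, rnorm (y - x) < e -> A y.
Proof.
split=> [/nbhs_normP[e /= e0 eA]|[e e0 eA]].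
  exists (complex.Re e).
    by rewrite -ltcR RRe_real// gtr0_real.
  move=> y ye; apply: eA => /=; rewrite distrC rnormE.
  by rewrite -[ltRHS]RRe_real ?ltcR// gtr0_real.
apply/nbhs_normP; exists e%:C => /=; first by rewrite ltcR.
by move=> y /=; rewrite distrC rnormE ltcR => /eA.
Qed.

Lemma closure_rnormP (V : normedModType R[i]) (A : set V) (x : V) :
  closure A x <-> forall e : R, 0 < e -> exists2 y, A y & rnorm (y - x) < e.
Proof.
split=> [clA e e0|h B /nbhs_rnormP[e e0 eB]].
  have [|y [Ay ye]] := clA [set y | rnorm (y - x) < e]; last by exists y.
  by apply/nbhs_rnormP; exists e.
by have [y Ay /eB By] := h e e0; exists y.
Qed.

Lemma rnorm_complete (V : completeNormedModType R[i]) (u : nat -> V) :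
  (forall e : R, 0 < e -> exists N, forall m n, (N <= m)%N -> (N <= n)%N ->
     rnorm (u m - u n) < e) ->
  exists l, forall e : R, 0 < e ->
    exists N, forall n, (N <= n)%N -> rnorm (u n - l) < e.
Proof.
move=> cu; have /cauchy_cvgP/cvg_ex[l ul] : cauchy (u @ \oo).
  apply: cauchy_exP => e e0.
  have [|N hN] := cu (complex.Re e).
    by rewrite -ltcR RRe_real// gtr0_real.
  exists (u N); exists N => // n /= Nn; rewrite -ball_normE /= rnormE.
  by rewrite -[ltRHS]RRe_real ?gtr0_real// ltcR hN.
exists l => e e0.
have /ul[N _ hN] : nbhs l [set y | rnorm (y - l) < e].
  by apply/nbhs_rnormP; exists e.
by exists N => n /hN.
Qed.

Section Continuity.
Variables (E : set R[i]).

(** The subtype carries the initial topology of [set_val], so its open sets are preimages of open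
    sets of [R[i]]. *)
Lemma nbhs_set_type (t : E) (A : set E) :
  nbhs t A <-> exists2 e : R, 0 < e &
    forall s : E, rnorm (set_val s - set_val t) < e -> A s.
Proof.
split.
  case=> B [[C oC CB] Bt] BA.
  have /nbhs_rnormP[e e0 eC] : nbhs (set_val t) C.
    by apply: open_nbhs_nbhs; split=> //; move: Bt; rewrite -CB.
  by exists e => // s /eC Cs; apply: BA; rewrite -CB.
case=> e e0 eA.
have : nbhs (set_val t) [set z | rnorm (z - set_val t) < e].
  by apply/nbhs_rnormP; exists e.
rewrite nbhsE => -[C [oC Ct] CA].
exists (set_val @^-1` C); split=> //; first by exists C.
by move=> s /CA /eA.
Qed.

Lemma continuous_rnormP (f : E -> R[i]) :
  continuous f <-> forall t (e : R), 0 < e -> exists2 d : R, 0 < d &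
    forall s, rnorm (set_val s - set_val t) < d -> rnorm (f s - f t) < e.
Proof.
split=> [cf t e e0|h t A /= /nbhs_rnormP[e e0 eA]].
  apply/(nbhs_set_type t [set s | rnorm (f s - f t) < e]).
  by apply: (cf t [set y | rnorm (y - f t) < e]); apply/nbhs_rnormP; exists e.
by have [d d0 hd] := h t e e0; apply/nbhs_set_type; exists d => // s /hd /eA.
Qed.

(** Supplies the bundled functions that the axioms of the calculus ask for, known only through their
    values. *)
Lemma mkcts_ex (f : E -> R[i]) : continuous f ->
  exists g : continuousType E R[i], forall t, g t = f t.
Proof. by move=> cf; exists (mkcts cf). Qed.

End Continuity.
End RealNorm.

(** * Hilbert spaces *)

Section InnerProduct.
Variables (R : realType) (K : completeNormedModType R[i]).
Variable ip : {dot K for Num.conj}.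
Hypothesis K_hilbert : hilbert_norm ip.
Implicit Types (x y z : K) (a : R[i]) (r : R).

Lemma ipDl x y z : ip (x + y) z = ip x z + ip y z.
Proof. exact: linearDl. Qed.

Lemma ipZl a x z : ip (a *: x) z = a * ip x z.
Proof. exact: linearZl_LR. Qed.

Lemma ipC x y : ip x y = (ip y x)^*.
Proof. by rewrite (hermC ip x y) expr0 mul1r. Qed.

Lemma ipDr x y z : ip x (y + z) = ip x y + ip x z.
Proof. by rewrite ipC ipDl rmorphD /= -!ipC. Qed.

Lemma ipZr a x y : ip x (a *: y) = a^* * ip x y.
Proof. by rewrite ipC ipZl rmorphM /= -!ipC. Qed.

Lemma ipNl x y : ip (- x) y = - ip x y.
Proof. by rewrite -scaleN1r ipZl mulN1r. Qed.

Lemma ipNr x y : ip x (- y) = - ip x y.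
Proof. by rewrite ipC ipNl rmorphN /= -ipC. Qed.

Lemma ip0l x : ip 0 x = 0.
Proof. by rewrite -(scale0r x) ipZl mul0r. Qed.

Lemma ip0r x : ip x 0 = 0.
Proof. by rewrite ipC ip0l conjC0. Qed.

Lemma ip_rnorm x : ip x x = (rnorm x ^+ 2)%:C.
Proof.
by rewrite rmorphXn/= -rnormE K_hilbert /ipnorm sqrtCK.
Qed.

Definition re_ip x y : R := complex.Re (ip x y).
Local Notation rip := re_ip.

Lemma ripDl x y z : rip (x + y) z = rip x z + rip y z.
Proof. by rewrite /re_ip ipDl raddfD. Qed.

Lemma ripDr x y z : rip x (y + z) = rip x y + rip x z.
Proof. by rewrite /re_ip ipDr raddfD. Qed.

Lemma ripC x y : rip x y = rip y x.
Proof. by rewrite /re_ip ipC; case: (ip y x). Qed.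

Lemma ripZl r x y : rip (r%:C *: x) y = r * rip x y.
Proof. by rewrite /re_ip ipZl; case: (ip x y) => b c /=; rewrite mul0r subr0. Qed.

Lemma ripZr r x y : rip x (r%:C *: y) = r * rip x y.
Proof. by rewrite ripC ripZl ripC. Qed.

Lemma ripNl x y : rip (- x) y = - rip x y.
Proof. by rewrite -scaleN1r -[-1](rmorphN1 (real_complex R)) ripZl mulN1r. Qed.

Lemma ripNr x y : rip x (- y) = - rip x y.
Proof. by rewrite ripC ripNl ripC. Qed.

Lemma ripxx x : rip x x = rnorm x ^+ 2.
Proof. by rewrite /re_ip ip_rnorm. Qed.

Lemma rnormD_sqr x y :
  rnorm (x + y) ^+ 2 = rnorm x ^+ 2 + 2 * rip x y + rnorm y ^+ 2.
Proof. rewrite -!ripxx !(ripDl, ripDr) (ripC y x); ring. Qed.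

(** Cauchy-Schwarz for the real part is the square of the triangle inequality, which [K] already
    satisfies. *)
Lemma rip_le x y : rip x y <= rnorm x * rnorm y.
Proof.
have := rnormD x y; rewrite -(ler_pXn2r (isT : (0 < 2)%N)) ?nnegrE ?addr_ge0 ?rnorm_ge0//.
rewrite rnormD_sqr => h; nra.
Qed.

(** Multiplying [x] by the conjugate of [ip x y] makes the inner product equal to [|ip x y|^2], so
    the real case applies and one factor cancels. *)
Lemma ip_le x y : rnorm (ip x y) <= rnorm x * rnorm y.
Proof.
have [->|n0] := eqVneq (ip x y) 0; first by rewrite rnorm0 mulr_ge0 ?rnorm_ge0.
have n1 : 0 < rnorm (ip x y) by rewrite rnorm_gt0.
have : rip ((ip x y)^* *: x) y <= rnorm ((ip x y)^* *: x) * rnorm y.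
  exact: rip_le.
rewrite /re_ip ipZl mulrC mul_conj_rnorm rnormZ rnorm_conj /= expr2 -mulrA.
by rewrite ler_pM2l.
Qed.

(** The complex bound [M] is a nonnegative real as soon as some [x] is nonzero, because
    [0 <= M * |x|]. Adding [1] makes the real bound positive, so that later proofs may divide by
    it. *)
Lemma boundedP (T : K -> K) : bounded_operator T <->
  linear T /\ exists2 M : R, 0 < M & forall x, rnorm (T x) <= M * rnorm x.
Proof.
split=> -[lT]; last first.
  case=> M M0 hM; split=> //; exists M%:C => x.
  by rewrite !rnormE -rmorphM lecR.
case=> M hM; split=> //; exists (rnorm M + 1); first by rewrite ltr_wpDl ?rnorm_ge0.
move=> x; have [xz|x0] := eqVneq x 0.
  have := hM x; rewrite xz normr0 mulr0 normr_le0 => /eqP ->.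
  by rewrite !rnorm0 mulr0.
have Mr : M \is Num.real.
  have : 0 <= M * `|x| by apply: le_trans (hM x).
  by rewrite pmulr_lge0 ?normr_gt0// => /ger0_real.
have -> : rnorm M = `|complex.Re M| by rewrite -{1}(RRe_real Mr) rnorm_real.
have := hM x; rewrite !rnormE -(RRe_real Mr) -rmorphM lecR => /le_trans; apply.
by rewrite ler_wpM2r ?rnorm_ge0//= (le_trans (ler_norm _))// lerDl.
Qed.

Section LinearMap.
Variables (T : K -> K) (lT : linear T).

Lemma linD x y : T (x + y) = T x + T y.
Proof. by have := lT 1 x y; rewrite !scale1r. Qed.

Lemma lin0 : T 0 = 0.
Proof. by apply/(addrI (T 0)); rewrite -linD !addr0. Qed.

Lemma linZ a x : T (a *: x) = a *: T x.
Proof. by have := lT a x 0; rewrite lin0 !addr0. Qed.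

Lemma linN x : T (- x) = - T x.
Proof. by rewrite -scaleN1r linZ scaleN1r. Qed.

Lemma linB x y : T (x - y) = T x - T y.
Proof. by rewrite linD linN. Qed.

End LinearMap.

(** The lower bound makes [T] injective, which forces any chosen right inverse to be linear, and
    bounds it by [c^-1]. *)
Lemma surj_bounded_below_invertible (T : K -> K) (c : R) :
  linear T -> 0 < c -> (forall x, c * rnorm x <= rnorm (T x)) ->
  (forall y, exists x, T x = y) -> invertible_operator T.
Proof.
move=> lT c0 hT sT.
have [S TS] : exists S, forall y, T (S y) = y.
  by exists (fun y => projT1 (cid (sT y))) => y; case: cid.
have iT x y : T x = T y -> x = y.
  move=> Txy; apply/eqP; rewrite -subr_eq0 -rnorm_eq0 eq_le rnorm_ge0 andbT.
  by rewrite -(ler_pM2l c0) mulr0 (le_trans (hT _))// linB// Txy subrr rnorm0.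
exists S; split=> //; last by move=> x; apply: iT; rewrite TS.
apply/boundedP; split; first by move=> a x y; apply: iT; rewrite lT !TS.
exists c^-1; first by rewrite invr_gt0.
by move=> x; rewrite mulrC ler_pdivlMr// mulrC -{2}(TS x) hT.
Qed.

(* Lax-Milgram, by iterating the contraction [u |-> u - t (T u - y)]. *)
Lemma coercive_invertible (T : K -> K) (c : R) :
  bounded_operator T -> 0 < c ->
  (forall x, c * rnorm x ^+ 2 <= rip (T x) x) -> invertible_operator T.
Proof.
move=> /boundedP[lT [M M0 hM]] c0 hT.
have hb x : c * rnorm x <= rnorm (T x).
  have [->|x0] := eqVneq x 0; first by rewrite rnorm0 mulr0 rnorm_ge0.
  rewrite -(ler_pM2r (_ : 0 < rnorm x)) ?rnorm_gt0// -mulrA -expr2.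
  exact: le_trans (hT x) (rip_le _ _).
apply: (surj_bounded_below_invertible lT c0 hb) => y.
(* Since [|T d|^2 <= B |d|^2], a step multiplies the squared norm by at most [1 - 2 t c + t^2 B],
   which is least at [t = c / B], with value [k]. The summand [c ^+ 2] of [B] keeps [k]
   nonnegative. *)
pose B := M ^+ 2 + c ^+ 2; have B0 : 0 < B by rewrite addr_gt0 ?exprn_gt0.
pose t := c / B; have t0 : 0 < t by rewrite divr_gt0.
pose k := 1 - c ^+ 2 / B.
have k01 : 0 <= k < 1.
  rewrite subr_ge0 ler_pdivrMr// mul1r lerDr sqr_ge0/=.
  by rewrite ltrBlDr ltrDl divr_gt0// exprn_gt0.
pose s := Num.sqrt k.
have s0 : 0 <= s by rewrite sqrtr_ge0.
have s1 : s < 1 by rewrite -sqrtr1 ltr_sqrt//; case/andP: k01.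
have contr d : rnorm (d - t%:C *: T d) <= s * rnorm d.
  rewrite -(ler_pXn2r (isT : (0 < 2)%N)) ?nnegrE ?mulr_ge0 ?rnorm_ge0//.
  rewrite exprMn sqr_sqrtr; last by case/andP: k01.
  rewrite rnormD_sqr rnormN rnormZ rnorm_real gtr0_norm// exprMn ripNr ripZr ripC.
  have h1 := hT d.
  have h2 : rnorm (T d) ^+ 2 <= B * rnorm d ^+ 2.
    apply: (@le_trans _ _ (M ^+ 2 * rnorm d ^+ 2)).
      by rewrite -exprMn ler_pXn2r ?nnegrE ?mulr_ge0 ?rnorm_ge0 ?(ltW M0).
    by rewrite ler_wpM2r ?sqr_ge0// lerDl sqr_ge0.
  have h3 : t ^+ 2 * rnorm (T d) ^+ 2 <= t ^+ 2 * (B * rnorm d ^+ 2).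
    by rewrite ler_wpM2l// sqr_ge0.
  have h4 : t * (c * rnorm d ^+ 2) <= t * rip (T d) d by rewrite ler_wpM2l// ltW.
  have e1 : t ^+ 2 * (B * rnorm d ^+ 2) = c ^+ 2 / B * rnorm d ^+ 2.
    by rewrite /t; field; rewrite gt_eqF.
  have e2 : t * (c * rnorm d ^+ 2) = c ^+ 2 / B * rnorm d ^+ 2.
    by rewrite /t; field; rewrite gt_eqF.
  rewrite /k; lra.
pose u n := iter n (fun v => v - t%:C *: (T v - y)) 0.
pose d n := u n.+1 - u n.
have dE n : d n = - (t%:C *: (T (u n) - y)) by rewrite /d /u iterS addrC addKr.
have dS n : d n.+1 = d n - t%:C *: T (d n).
  rewrite dE (_ : T (u n.+1) = T (u n) + T (d n)).
    by rewrite addrAC scalerDr opprD -dE.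
  by rewrite -linD// /d addrC subrK.
have dn n : rnorm (d n) <= s ^+ n * rnorm (d 0%N).
  elim: n => [|n ih]; first by rewrite expr0 mul1r.
  by rewrite dS (le_trans (contr _))// exprS -mulrA ler_wpM2l.
(* Geometric tail by induction: the first step costs [|d n|], the others at most
   [s |d n| / (1 - s)]. *)
have tail m n : rnorm (u n - u (n + m)%N) <= rnorm (d n) / (1 - s).
  rewrite ler_pdivlMr ?subr_gt0//.
  elim: m n => [|m ih] n; first by rewrite addn0 subrr rnorm0 mul0r rnorm_ge0.
  rewrite -addSnnS.
  have h1 := ih n.+1; have h2 := contr (d n); rewrite -dS in h2.
  have h3 := rdistD (u n.+1) (u n) (u (n.+1 + m)%N).
  rewrite [rnorm (u n - u n.+1)]rdistC -/(d n) in h3.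
  have h4 : 0 <= rnorm (d n) by apply: rnorm_ge0.
  have h5 : rnorm (u n - u (n.+1 + m)%N) * (1 - s) <=
    (rnorm (d n) + rnorm (u n.+1 - u (n.+1 + m)%N)) * (1 - s).
    by rewrite ler_wpM2r// subr_ge0 ltW.
  nra.
have small e : 0 < e -> exists N, forall n, (N <= n)%N -> rnorm (d n) < e.
  move=> e0; have s1' : `|s| < 1 by rewrite ger0_norm.
  have /cvgrPdist_lt/(_ (e / (rnorm (d 0%N) + 1))) [|N _ hN] := cvg_expr s1'.
    by rewrite divr_gt0// ltr_wpDl ?rnorm_ge0.
  exists N => n /hN /=; rewrite sub0r normrN ger0_norm ?exprn_ge0//.
  rewrite ltr_pdivlMr ?ltr_wpDl ?rnorm_ge0// => h.
  apply: le_lt_trans (dn n) _; apply: le_lt_trans h.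
  by rewrite ler_wpM2l ?exprn_ge0// lerDl.
have [l hl] : exists l, forall e : R, 0 < e ->
    exists N, forall n, (N <= n)%N -> rnorm (u n - l) < e.
  apply: rnorm_complete => e e0.
  have [|N hN] := small (e / 2 * (1 - s)).
    by rewrite mulr_gt0 ?divr_gt0 ?subr_gt0.
  exists N => m n Nm Nn; apply: le_lt_trans (rdistD (u N) _ _) _.
  have hd : rnorm (d N) / (1 - s) < e / 2 by rewrite ltr_pdivrMr ?subr_gt0// hN.
  have := tail (m - N)%N N; have := tail (n - N)%N N; rewrite !subnKC//.
  rewrite (rdistC (u m)); lra.
exists l; apply/eqP; rewrite -subr_eq0 -rnorm_eq0 eq_le rnorm_ge0 andbT.
apply/ler_addgt0Pr => e e0; rewrite add0r.
(* The residual [T (u n) - y] is [- d n / t], so it tends to [0], and [T (u n)] tends to [T l]. *)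
have [|N1 h1] := small (t * (e / 2)); first by rewrite mulr_gt0 ?divr_gt0.
have [|N2 h2] := hl (e / 2 / M); first by rewrite !divr_gt0.
pose n := maxn N1 N2.
have {}h1 : rnorm (T (u n) - y) < e / 2.
  have := h1 n (leq_maxl _ _); rewrite dE rnormN rnormZ rnorm_real gtr0_norm//.
  by rewrite ltr_pM2l.
have {}h2 : rnorm (T l - T (u n)) < e / 2.
  rewrite -linB// (le_lt_trans (hM _))// mulrC -ltr_pdivlMr// rdistC.
  exact: h2 (leq_maxr _ _).
have := rdistD (T (u n)) (T l) y; lra.
Qed.

End InnerProduct.

(** * Spectral theory of self-adjoint operators *)

Section SelfAdjoint.
Variables (R : realType) (K : completeNormedModType R[i]).
Variable ip : {dot K for Num.conj}.
Hypothesis K_hilbert : hilbert_norm ip.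
Local Notation rip := (re_ip ip).
Implicit Types (T U : K -> K) (x y : K).

Lemma bounded_comp T U :
  bounded_operator T -> bounded_operator U -> bounded_operator (T \o U).
Proof.
move=> /boundedP[lT [M M0 hM]] /boundedP[lU [L L0 hL]]; apply/boundedP; split.
  by move=> a x y /=; rewrite lU lT.
exists (M * L) => [|x /=]; first exact: mulr_gt0.
by rewrite -mulrA (le_trans (hM _))// ler_wpM2l// ltW.
Qed.

Lemma bounded_add T U : bounded_operator T -> bounded_operator U ->
  bounded_operator (fun x => T x + U x).
Proof.
move=> /boundedP[lT [M M0 hM]] /boundedP[lU [L L0 hL]]; apply/boundedP; split.
  by move=> a x y /=; rewrite lU lT scalerDr addrACA.
exists (M + L) => [|x /=]; first exact: addr_gt0.
by rewrite mulrDl (le_trans (rnormD _ _))// lerD.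
Qed.

Lemma bounded_scale (a : R[i]) T : bounded_operator T ->
  bounded_operator (fun x => a *: T x).
Proof.
move=> /boundedP[lT [M M0 hM]]; apply/boundedP; split.
  by move=> b x y /=; rewrite lT scalerDr !scalerA mulrC.
exists ((rnorm a + 1) * M) => [|x /=].
  by rewrite mulr_gt0// ltr_wpDl ?rnorm_ge0.
by rewrite rnormZ -mulrA ler_pM ?rnorm_ge0// lerDl.
Qed.

Lemma bounded_id : bounded_operator (fun x : K => x).
Proof.
by apply/boundedP; split=> //; exists 1 => // x; rewrite mul1r.
Qed.

Lemma bounded_shift T (z : R[i]) : bounded_operator T ->
  bounded_operator (fun x => T x - z *: x).
Proof.
move=> bT; have := bounded_add bT (bounded_scale (- z) bounded_id).
by congr bounded_operator; apply/funext => x; rewrite scaleNr.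
Qed.

Lemma invertible_comp T U : invertible_operator T -> invertible_operator U ->
  invertible_operator (T \o U).
Proof.
move=> [S [bS TS ST]] [V [bV UV VU]]; exists (V \o S); split.
- exact: bounded_comp.
- exact: can_comp.
- exact: can_comp.
Qed.

Lemma invertible_bounded_below T : invertible_operator T ->
  exists2 c : R, 0 < c & forall x, c * rnorm x <= rnorm (T x).
Proof.
move=> [S [/boundedP[lS [M M0 hM]] ST TS]]; exists M^-1; first by rewrite invr_gt0.
by move=> x; rewrite mulrC ler_pdivrMr// mulrC -{1}(ST x).
Qed.

Lemma self_adjoint_shift T (r : R) : self_adjoint ip T ->
  self_adjoint ip (fun x => T x - r%:C *: x).
Proof.
move=> sT x y; rewrite -!scaleNr !(ipDl, ipDr, ipZl, ipZr) sT; congr (_ + _ * _).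
by rewrite -rmorphN; exact: esym (conjc_real _).
Qed.

(** [T \o T] is coercive, as its form at [x] is [|T x|^2]; its surjectivity gives that of [T]. *)
Lemma self_adjoint_invertible T (c : R) : bounded_operator T ->
  self_adjoint ip T -> 0 < c -> (forall x, c * rnorm x <= rnorm (T x)) ->
  invertible_operator T.
Proof.
move=> bT sT c0 hT; have [lT _] := (boundedP T).1 bT.
have [|S [_ _ TS]] := coercive_invertible K_hilbert (bounded_comp bT bT) (exprn_gt0 2 c0).
  move=> x; rewrite /re_ip sT -/(rip (T x) (T x)) ripxx//.
  by rewrite -exprMn ler_pXn2r ?nnegrE ?mulr_ge0 ?rnorm_ge0 ?(ltW c0).
apply: surj_bounded_below_invertible lT c0 hT _ => y.
by exists (T (S y)); exact: TS.
Qed.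

Section Spectrum.
Variable D : K -> K.
Hypotheses (D_bounded : bounded_operator D) (D_sa : self_adjoint ip D).

Lemma self_adjoint_ip_real x : ip (D x) x = (rip (D x) x)%:C.
Proof.
have := ipC ip (D x) x; rewrite /re_ip D_sa; case: (ip x (D x)) => a b [] bb.
by congr Complex => /=; lra.
Qed.

(** The imaginary part of the form of [D - z] at [x] is [- Im z |x|^2], so multiplying the operator
    by [i Im z] makes it coercive. *)
Lemma spectrum_real (z : R[i]) : spectrum D z -> complex.Im z = 0.
Proof.
move=> zD; apply/eqP/negP => /negP Iz; apply: zD.
pose c := complex.Im z.
pose w : R[i] := Complex 0 c.
have bT := bounded_scale w (bounded_shift z D_bounded).
have c2 : 0 < c ^+ 2 by rewrite exprn_even_gt0.
have hT x : c ^+ 2 * rnorm x ^+ 2 <= rip (w *: (D x - z *: x)) x.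
  rewrite /re_ip -scaleNr ipZl ipDl ipZl ip_rnorm// self_adjoint_ip_real.
  rewrite [complex.Re _](_ : _ = c ^+ 2 * rnorm x ^+ 2)//.
  rewrite /w /c; case: (z) => a b /=; ring.
have [S [bS ST TS]] := coercive_invertible K_hilbert bT c2 hT.
have w0 : w != 0 by rewrite eq_complex /= eqxx.
exists (fun x => S (w *: x)); split.
- have := bounded_comp bS (bounded_scale w bounded_id).
  by congr bounded_operator.
- by move=> x; apply: ST.
- by move=> x; apply: (scalerI w0); apply: TS.
Qed.

Lemma spectrum_Re (z : R[i]) : spectrum D z -> z = (complex.Re z)%:C.
Proof. by move=> /spectrum_real; case: z => a b /= ->. Qed.

Lemma spectrum_below (r : R) (c : R) : 0 < c ->
  (forall x, c * rnorm x <= rnorm (D x - r%:C *: x)) -> ~ spectrum D r%:C.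
Proof.
move=> c0 hc; apply; apply: self_adjoint_invertible c0 hc.
  exact: bounded_shift.
exact: self_adjoint_shift.
Qed.

(** If [|z|] exceeds the bound [M] of [D], then [D - z] is bounded below by [|z| - M]. *)
Lemma spectrum_bounded : exists2 M : R, 0 < M &
  forall z, spectrum D z -> rnorm z <= M.
Proof.
have [lD [M M0 hM]] := (boundedP D).1 D_bounded; exists M => // z zD.
rewrite leNgt; apply/negP => Mz; have := zD; rewrite (spectrum_Re zD).
apply: (@spectrum_below _ (rnorm z - M)); first by rewrite subr_gt0.
move=> x; rewrite -(spectrum_Re zD).
have := rdistD (D x) (z *: x) 0; rewrite !subr0 rnormZ rdistC.
have := hM x; lra.
Qed.

(** A lower bound [c] for [D - r] leaves the lower bound [c / 2] for [D - s] when
    [|s - r| < c / 2]. *)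
Lemma spectrum_closed (r : R) : ~ spectrum D r%:C ->
  exists2 e : R, 0 < e & forall s : R, `|s - r| < e -> ~ spectrum D s%:C.
Proof.
move=> /contrapT/invertible_bounded_below[c c0 hc]; exists (c / 2).
  by rewrite divr_gt0.
move=> s sr; apply: (@spectrum_below _ (c / 2)); first by rewrite divr_gt0.
move=> x.
have := rdistD (D x - s%:C *: x) (D x - r%:C *: x) 0; rewrite !subr0.
have -> : D x - r%:C *: x - (D x - s%:C *: x) = (s - r)%:C *: x.
  by rewrite rmorphB scalerBl opprB addrC addrA subrK.
rewrite rnormZ rnorm_real; have := hc x.
have : `|s - r| * rnorm x <= c / 2 * rnorm x by rewrite ler_wpM2r ?rnorm_ge0 ?ltW.
lra.
Qed.

(** Otherwise, by homogeneity, [D - z] is bounded below by [e], which a self-adjoint operator cannot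
    be at a spectral value. *)
Lemma spectrum_approx_eigenvector (z : R[i]) (e : R) : spectrum D z -> 0 < e ->
  exists2 x, rnorm x = 1 & rnorm (D x - z *: x) < e.
Proof.
move=> zD e0; have [lD _] := (boundedP D).1 D_bounded.
apply: contrapT => hn; move: (zD); rewrite (spectrum_Re zD).
apply: (@spectrum_below _ e) => // x; rewrite -(spectrum_Re zD) leNgt.
apply/negP => xe; apply: hn.
have [x0|x0] := eqVneq x 0.
  by move: xe; rewrite x0 rnorm0 mulr0 ltNge rnorm_ge0.
have n0 : 0 < rnorm x by rewrite rnorm_gt0.
have nV : rnorm ((rnorm x)^-1)%:C = (rnorm x)^-1.
  by rewrite rnorm_real gtr0_norm// invr_gt0.
exists (((rnorm x)^-1)%:C *: x); first by rewrite rnormZ nV mulVf// gt_eqF.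
rewrite linZ// scalerA mulrC -scalerA -scalerBr rnormZ nV mulrC.
by rewrite ltr_pdivrMr.
Qed.

(* For P = D - m >= 0 with norm at most N, expanding <P v, v> >= 0 at
   v = x - P x / N gives |P x|^2 <= N <P x, x>, so P is bounded below only if
   m is not optimal. *)
Lemma inf_numrange_spectrum : (exists x : K, x != 0) -> exists2 m : R,
  forall x, m * rnorm x ^+ 2 <= rip (D x) x & spectrum D m%:C.
Proof.
move=> [x0 x0n]; have [lD [M M0 hM]] := (boundedP D).1 D_bounded.
pose A := [set rip (D x) x / rnorm x ^+ 2 | x in [set x | x != 0]].
have A0 : A !=set0 by exists (rip (D x0) x0 / rnorm x0 ^+ 2); exists x0.
have nD x : - (M * rnorm x ^+ 2) <= rip (D x) x.
  have := rip_le K_hilbert (- D x) x; rewrite ripNl rnormN.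
  have := hM x; have := rnorm_ge0 x; nra.
have lA : has_lbound A.
  exists (- M) => _ [x /= xn <-]; rewrite ler_pdivlMr ?exprn_gt0 ?rnorm_gt0//.
  by rewrite mulNr.
have iA : has_inf A by [].
pose m := inf A.
have hm x : m * rnorm x ^+ 2 <= rip (D x) x.
  have [->|xn] := eqVneq x 0.
    by rewrite rnorm0 expr0n mulr0 (lin0 lD) ripxx// sqr_ge0.
  rewrite -ler_pdivlMr ?exprn_gt0 ?rnorm_gt0//.
  by apply: ge_inf => //; exists x.
exists m => // inv; have [c c0 hc] := invertible_bounded_below inv.
pose P x := D x - m%:C *: x.
have bP : bounded_operator P by exact: bounded_shift.
have sP : self_adjoint ip P by exact: self_adjoint_shift.
have [lP [N N0 hN]] := (boundedP P).1 bP.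
have PE x : rip (P x) x = rip (D x) x - m * rnorm x ^+ 2.
  by rewrite /P ripDl ripNl ripZl ripxx.
have P0 x : 0 <= rip (P x) x by rewrite PE subr_ge0.
change (forall x, c * rnorm x <= rnorm (P x)) in hc; clearbody P.
have hP x : rnorm (P x) ^+ 2 <= N * rip (P x) x.
  have := P0 (x - (N^-1)%:C *: P x).
  rewrite (linB lP) (linZ lP) !(ripDl, ripDr, ripNl, ripNr, ripZl, ripZr).
  rewrite [rip (P (P x)) x](_ : _ = rip (P x) (P x)); last by rewrite /re_ip sP.
  rewrite ripxx//.
  have := rip_le K_hilbert (P (P x)) (P x); have := hN (P x).
  have := rnorm_ge0 (P x).
  set a := rnorm (P x); set b := rnorm (P (P x)); set g := rip (P (P x)) (P x).
  set f := rip (P x) x => a0 h1 h2 h3.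
  have h4 : g <= N * a ^+ 2 by rewrite (le_trans h2)// expr2 mulrA ler_wpM2r.
  have h5 : N^-1 * (N^-1 * g) <= N^-1 * (N^-1 * (N * a ^+ 2)).
    by rewrite !ler_wpM2l// invr_ge0 ltW.
  have h6 : N^-1 * (N^-1 * (N * a ^+ 2)) = N^-1 * a ^+ 2.
    by field; rewrite gt_eqF.
  have h7 : N^-1 * a ^+ 2 <= f by lra.
  by move: h7; rewrite mulrC ler_pdivrMr// mulrC.
(* A lower bound [c] for [P] lifts every quotient to at least [m + c ^+ 2 / N]; a quotient below
   this value gives the contradiction. *)
have d0 : 0 < c ^+ 2 / N by rewrite divr_gt0// exprn_gt0.
have [_ [x /= xn <-]] := inf_adherent d0 iA.
rewrite ltNge => /negP; apply; rewrite -/m ler_pdivlMr ?exprn_gt0 ?rnorm_gt0//.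
have h1 : (c * rnorm x) ^+ 2 <= rnorm (P x) ^+ 2.
  by rewrite ler_pXn2r ?nnegrE ?mulr_ge0 ?rnorm_ge0 ?(ltW c0) ?hc.
have h2 := hP x.
have h3 : c ^+ 2 / N * rnorm x ^+ 2 <= rip (P x) x.
  by rewrite mulrAC ler_pdivrMr// [leRHS]mulrC -exprMn (le_trans h1).
by move: h3; rewrite PE; lra.
Qed.

End Spectrum.
End SelfAdjoint.

(** * Polynomials of a self-adjoint operator *)

Section PolynomialCalculus.
Variables (R : realType) (K : completeNormedModType R[i]).

Definition poly_op (D : K -> K) (p : {poly R[i]}) (x : K) : K :=
  \sum_(i < size p) p`_i *: iter i D x.

Section Linear.
Variables (D : K -> K) (D_linear : linear D).
Implicit Types (p q : {poly R[i]}) (x y : K).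
Local Notation peval := (poly_op D).

Lemma peval_widen n p x : (size p <= n)%N ->
  peval p x = \sum_(i < n) p`_i *: iter i D x.
Proof.
move=> pn; rewrite /poly_op (big_ord_widen _ (fun i => p`_i *: iter i D x) pn).
rewrite big_mkcond; apply: eq_bigr => i _; case: ltnP => // h.
by rewrite nth_default// scale0r.
Qed.

Lemma pevalD p q x : peval (p + q) x = peval p x + peval q x.
Proof.
pose n := maxn (size p) (size q).
rewrite !(@peval_widen n) ?leq_maxl ?leq_maxr//; last exact: size_polyD.
by rewrite -big_split/=; apply: eq_bigr => i _; rewrite coefD scalerDl.
Qed.

Lemma pevalZ (a : R[i]) p x : peval (a *: p) x = a *: peval p x.
Proof.
rewrite (@peval_widen (size p)) ?size_scale_leq// /poly_op scaler_sumr.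
by apply: eq_bigr => i _; rewrite coefZ scalerA.
Qed.

Lemma pevalC (a : R[i]) x : peval a%:P x = a *: x.
Proof.
by rewrite (@peval_widen 1) ?size_polyC_leq1// big_ord1 coefC.
Qed.

Lemma pevalB p q x : peval (p - q) x = peval p x - peval q x.
Proof. by rewrite pevalD -scaleN1r pevalZ scaleN1r. Qed.

Lemma pevalMX p x : peval (p * 'X) x = D (peval p x).
Proof.
rewrite (@peval_widen (size p).+1); last first.
  by rewrite (leq_trans (size_polyMleq _ _))// size_polyX addn2.
rewrite big_ord_recl coefMX scale0r add0r.
rewrite /poly_op (big_morph D (linD D_linear) (lin0 D_linear)).
by apply: eq_bigr => i _; rewrite coefMX/= linZ.
Qed.

Lemma pevalX x : peval 'X x = D x.
Proof. by rewrite -['X]mul1r pevalMX -[1]/(1%:P) pevalC scale1r. Qed.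

Lemma pevalM p q x : peval (p * q) x = peval p (peval q x).
Proof.
elim/poly_ind: p => [|p a ih].
  by rewrite mul0r -[0]/(0%:P) !pevalC !scale0r.
rewrite mulrDl !pevalD mulrAC !pevalMX ih.
by rewrite mul_polyC pevalZ pevalC.
Qed.

End Linear.

Section Bounded.
Variables (D : K -> K) (D_bounded : bounded_operator D).
Implicit Types (p q : {poly R[i]}) (x y : K).
Local Notation peval := (poly_op D).
Let D_linear : linear D := D_bounded.1.

Lemma bounded_peval p : bounded_operator (peval p).
Proof.
elim/poly_ind: p => [|p a ih].
  have := bounded_scale 0 (bounded_id K); congr bounded_operator.
  by apply/funext => x; rewrite -[0 in RHS]/(0%:P) pevalC.
have := bounded_add (bounded_comp D_bounded ih) (bounded_scale a (bounded_id K)).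
by congr bounded_operator; apply/funext => x; rewrite pevalD pevalMX// pevalC.
Qed.

(** One half of the spectral mapping theorem: [p] splits over [R[i]], so [p(D)] is a composition of
    a nonzero scalar and the invertible operators [D - z] at its roots. *)
Lemma peval_invertible (p : {poly R[i]}) : p != 0 ->
  (forall z, root p z -> ~ spectrum D z) -> invertible_operator (peval p).
Proof.
move=> p0; have [r pE] := closed_field_poly_normal p; rewrite pE => hr.
have {}hr z : z \in r -> ~ spectrum D z.
  move=> zr; apply: hr; rewrite rootZ ?lead_coef_eq0//.
  by rewrite root_prod_XsubC.
have -> : peval (lead_coef p *: \prod_(z <- r) ('X - z%:P)) =
    (fun x => lead_coef p *: peval (\prod_(z <- r) ('X - z%:P)) x).
  by apply/funext => x; rewrite pevalZ.
have inv_scale (a : R[i]) (a0 : a != 0) : invertible_operator (fun x : K => a *: x).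
  exists (fun x => a^-1 *: x); split.
  - exact: bounded_scale (bounded_id K).
  - by move=> x; rewrite scalerA mulVf// scale1r.
  - by move=> x; rewrite scalerA mulfV// scale1r.
apply: (@invertible_comp _ _ (fun x => lead_coef p *: x)).
  by apply: inv_scale; rewrite lead_coef_eq0.
elim: r hr {pE} => [|z r ih] hr.
  have := inv_scale 1 (oner_neq0 _); congr invertible_operator.
  by apply/funext => x; rewrite big_nil -[1 in RHS]/(1%:P) pevalC.
rewrite big_cons.
have -> : peval (('X - z%:P) * \prod_(j <- r) ('X - j%:P)) =
  (fun x => D x - z *: x) \o peval (\prod_(j <- r) ('X - j%:P)).
  by apply/funext => x; rewrite pevalM// pevalB pevalX// pevalC.
apply: invertible_comp; last by apply: ih => y yr; apply: hr; rewrite inE yr orbT.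
by apply: contrapT; apply: hr; rewrite inE eqxx.
Qed.

End Bounded.

Section SelfAdjoint.
Variable ip : {dot K for Num.conj}.
Hypothesis K_hilbert : hilbert_norm ip.
Hypothesis K_neq0 : exists x : K, x != 0.
Variables (D : K -> K) (D_bounded : bounded_operator D).
Hypothesis D_sa : self_adjoint ip D.
Implicit Types (p q : {poly R[i]}) (x y : K).
Local Notation peval := (poly_op D).
Local Notation rip := (re_ip ip).
Let D_linear : linear D := D_bounded.1.

(** For self-adjoint [D] this polynomial gives the adjoint of [p(D)], and at the real spectral
    values it takes the conjugate values. *)
Definition conjp p : {poly R[i]} := map_poly Num.conj p.

Lemma adjoint_peval p : adjoint_of ip (peval p) (peval (conjp p)).
Proof.
rewrite /conjp; elim/poly_ind: p => [|p a ih] x y.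
  by rewrite rmorph0 -[0]/(0%:P) !pevalC ipZl ipZr conjC0 !mul0r.
rewrite rmorphD rmorphM/= map_polyX map_polyC/= !pevalD ipDl ipDr; congr (_ + _).
  by rewrite pevalM// pevalX// pevalMX// ih D_sa.
by rewrite !pevalC ipZl ipZr conjCK.
Qed.

Lemma horner_conjp p (z : R[i]) : spectrum D z -> (conjp p).[z] = (p.[z])^*.
Proof.
move=> /(spectrum_Re K_hilbert D_bounded D_sa) ->.
rewrite -[in RHS]horner_map/=; congr (_.[_]); exact: esym (conjc_real _).
Qed.

Lemma spectrum_nonempty : exists z, spectrum D z.
Proof.
have [m _ mD] := inf_numrange_spectrum K_hilbert D_bounded D_sa K_neq0.
by exists m%:C.
Qed.

Lemma peval_ge0 p : self_adjoint ip (peval p) ->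
  (forall z, spectrum D z -> 0 <= complex.Re p.[z]) ->
  forall x, 0 <= rip (peval p x) x.
Proof.
move=> sp hp x; have bp := bounded_peval D_bounded p.
have [m hm mp] := inf_numrange_spectrum K_hilbert bp sp K_neq0.
suff [z zD pz] : exists2 z, spectrum D z & p.[z] = m%:C.
  apply: le_trans (hm x); apply: mulr_ge0; last exact: sqr_ge0.
  by have := hp z zD; rewrite pz.
(* Factoring needs a nonzero polynomial; if [p] is the constant [m], any point of the nonempty
   spectrum will do. *)
have [pm|pm] := eqVneq (p - m%:C%:P) 0.
  have [z zD] := spectrum_nonempty; exists z => //.
  by move/eqP: pm; rewrite subr_eq0 => /eqP ->; rewrite hornerC.
apply: contrapT => hn; apply: mp.
have := @peval_invertible D D_bounded _ pm.
rewrite [poly_op D (p - _)](_ : _ = fun x => peval p x - m%:C *: x); last first.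
  by apply/funext => y; rewrite pevalB pevalC.
apply=> z; rewrite rootE hornerD hornerN hornerC subr_eq0 => /eqP pz zD.
by apply: hn; exists z.
Qed.

(** Positivity at [e^2 - conjp p * p], whose value at a spectral point is [e^2 - |p|^2] and whose
    form at [x] is [e^2 |x|^2 - |p(D) x|^2]. *)
Lemma peval_norm_le p (e : R) : 0 <= e ->
  (forall z, spectrum D z -> rnorm p.[z] <= e) ->
  forall x, rnorm (peval p x) <= e * rnorm x.
Proof.
move=> e0 hp x; pose q := (e ^+ 2)%:C%:P - conjp p * p.
have qE y : peval q y = (e ^+ 2)%:C *: y - peval (conjp p) (peval p y).
  by rewrite pevalB pevalC pevalM.
have ppE y z : ip (peval (conjp p) y) z = ip y (peval p z).
  by rewrite ipC -adjoint_peval -ipC.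
have sq : self_adjoint ip (peval q).
  move=> y z; rewrite !qE ipDl ipDr ipNl ipNr ipZl ipZr ppE adjoint_peval.
  by congr (_ * _ + _); exact: esym (conjc_real _).
have := peval_ge0 sq; move=> /(_ _ x); rewrite qE ripDl ripNl ripZl ripxx//.
rewrite [rip (peval (conjp p) _) _](_ : _ = rip (peval p x) (peval p x)); last first.
  by rewrite /re_ip ppE.
rewrite ripxx// subr_ge0 => h.
rewrite -(ler_pXn2r (isT : (0 < 2)%N)) ?nnegrE ?mulr_ge0 ?rnorm_ge0// exprMn.
apply: h => z zD; rewrite hornerD hornerN hornerC hornerM horner_conjp//.
rewrite mulrC mul_conj_rnorm /= subr_ge0 ler_pXn2r ?nnegrE ?rnorm_ge0//.
exact: hp.
Qed.

End SelfAdjoint.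
End PolynomialCalculus.

(** * Polynomial approximation on a segment *)

Section Approximation.
Variable R : realType.
Implicit Types (M a d e s : R).

(* The increasing iteration for the square root of [s ^ 2]; its limit on [-1, 1]
   is [|s|]. *)
Fixpoint abs_poly n : {poly R} :=
  if n is m.+1 then abs_poly m + 2^-1 *: ('X^2 - abs_poly m ^+ 2) else 0.

(** With [b = |s|], current value [q] and error [f = b - q], the next error is
    [f (1 - (b + q) / 2) <= f (1 - f / 2)]. Either [f] is already at most [2 / (n + 2)], or this is
    at most [2 / (n + 1) * (1 - 1 / (n + 2)) = 2 / (n + 2)]. *)
Lemma abs_polyP n s : `|s| <= 1 ->
  0 <= (abs_poly n).[s] <= `|s| /\ `|s| - (abs_poly n).[s] <= 2 / n.+1%:R.
Proof.
move=> s1; elim: n => [|n [/andP[q0 qs] hq]] /=.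
  by rewrite horner0 lexx normr_ge0 subr0 divr1; split=> //; lra.
rewrite !hornerE/=; set q := _.[s] in q0 qs hq *; rewrite -(real_normK (num_real s)).
move: `|s| s1 qs hq => b b1 qb hq; clearbody q.
have n0 : 0 < (n.+1%:R : R) by rewrite ltr0n.
have m0 : 0 < (n.+2%:R : R) by rewrite ltr0n.
have hh : 0 <= (b - q) * (2 - b - q) by rewrite mulr_ge0//; lra.
have hh2 : 0 <= (b - q) * (b + q) by rewrite mulr_ge0//; lra.
split; first by apply/andP; split; nra.
pose f := b - q; have f0 : 0 <= f by rewrite subr_ge0.
apply: (@le_trans _ _ (f * (1 - f / 2))); first by rewrite /f; nra.
have [fs|fs] := lerP f (2 / n.+2%:R).
  by apply: le_trans fs; nra.
apply: (@le_trans _ _ ((2 / n.+1%:R) * (1 - n.+2%:R^-1))).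
  have h1 : f <= 2 / n.+1%:R by [].
  have h2 : 1 - f / 2 <= 1 - n.+2%:R^-1.
    by move: n.+2%:R^-1 fs => v fs; lra.
  by apply: ler_pM => //; rewrite /f; lra.
rewrite le_eqVlt; apply/orP; left; apply/eqP.
move: m0; rewrite -[n.+2%:R]natr1; move: n.+1%:R n0 => v v0 v1; field.
by rewrite !gt_eqF.
Qed.

Definition poly_approx M (g : R -> R) := forall e, 0 < e ->
  exists p : {poly R}, forall s, `|s| <= M -> `|p.[s] - g s| < e.

Lemma poly_approxD M g1 g2 : poly_approx M g1 -> poly_approx M g2 ->
  poly_approx M (fun s => g1 s + g2 s).
Proof.
move=> h1 h2 e e0; have e2 : 0 < e / 2 by rewrite divr_gt0.
have [p hp] := h1 _ e2; have [q hq] := h2 _ e2.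
exists (p + q) => s sM; rewrite hornerD opprD addrACA.
by rewrite (le_lt_trans (ler_normD _ _))// [e]splitr ltrD ?hp ?hq.
Qed.

Lemma poly_approxZ M a g : poly_approx M g -> poly_approx M (fun s => a * g s).
Proof.
move=> h e e0; have a1 : 0 < `|a| + 1 by rewrite ltr_wpDl.
have [p hp] := h (e / (`|a| + 1)) (divr_gt0 e0 a1).
exists (a *: p) => s sM; rewrite hornerZ -mulrBr normrM.
have := hp s sM; rewrite ltr_pdivlMr// mulrC => hlt.
by apply: le_lt_trans hlt; rewrite ler_wpM2r// lerDl.
Qed.

Lemma poly_approx_dist M a : 0 <= M -> poly_approx M (fun s => `|s - a|).
Proof.
(* [L] bounds [|s - a|] on the segment, so [(s - a) / L] lies in [[-1, 1]]; rescaling turns the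
   error [2 / (n + 1)] into [2 L / (n + 1)], whence the choice of [n]. *)
move=> M0 e e0; pose L := M + `|a| + 1.
have L0 : 0 < L by rewrite ltr_wpDl// addr_ge0.
have [n hn] : exists n, 2 * L / e < n.+1%:R.
  exists (Num.bound (2 * L / e)); rewrite (lt_trans (archi_boundP _))//; last by
    rewrite ltr_nat.
  by rewrite divr_ge0 ?mulr_ge0 ?ltW.
exists (L *: (abs_poly n \Po (L^-1 *: ('X - a%:P)))) => s sM.
rewrite hornerZ horner_comp !hornerE/=.
set y := L^-1 * (s - a).
have y1 : `|y| <= 1.
  rewrite normrM gtr0_norm ?invr_gt0// mulrC ler_pdivrMr// mul1r.
  by rewrite (le_trans (ler_normB _ _))// /L; lra.
have -> : `|s - a| = L * `|y|.
  by rewrite normrM gtr0_norm ?invr_gt0// mulrA mulfV ?mul1r// gt_eqF.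
have [/andP[_ h1] h2] := abs_polyP n y1.
rewrite -mulrBr normrM gtr0_norm// distrC ger0_norm ?subr_ge0//.
apply: (@le_lt_trans _ _ (L * (2 / n.+1%:R))); first by rewrite ler_pM2l.
by move: hn; rewrite ltr_pdivrMr// mulrA [L * 2]mulrC ltr_pdivrMr ?ltr0n// [_ * e]mulrC.
Qed.

(* The tent [max 0 (1 - |v|)]. *)
Definition hat (v : R) : R := (`|v - 1| + `|v + 1|) / 2 - `|v|.

Lemma hat_ge0 v : 0 <= hat v.
Proof.
rewrite /hat; have := ler_normD (v - 1) (v + 1).
have -> : v - 1 + (v + 1) = 2 * v by ring.
rewrite normrM ger0_norm//; lra.
Qed.

Lemma hat_supp v : hat v != 0 -> `|v| < 1.
Proof.
rewrite ltNge; apply: contraNN; rewrite ler_normr /hat => /orP[h|h].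
  by rewrite !ger0_norm; [apply/eqP; lra|lra..].
by rewrite !ler0_norm; [apply/eqP; lra|lra..].
Qed.

(** A tent is half the second difference of [|u - k|] in [k], so the sum telescopes; the end values
    [c n.+1] and [c 0] are [1] and [-1]. *)
Lemma hat_sum n u : 0 <= u <= n%:R -> \sum_(k < n.+1) hat (u - k%:R) = 1.
Proof.
move=> /andP[u0 un]; pose c k := `|u - k%:R| - `|u - k%:R + 1|.
have cE k : c k.+1 = `|u - k%:R - 1| - `|u - k%:R|.
  by rewrite /c -natr1 opprD addrA subrK.
have hE k : hat (u - k%:R) = 2^-1 * (c k.+1 - c k).
  by rewrite cE /hat /c; field.
under eq_bigr do rewrite hE.
rewrite -mulr_sumr -(big_mkord xpredT (fun k => c k.+1 - c k)) telescope_sumr//.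
rewrite cE /c subr0 (ger0_norm u0) (@ger0_norm _ (u + 1)); last by lra.
rewrite !ler0_norm; [|lra..].
by field.
Qed.

Lemma hat_lipschitz v w : `|hat v - hat w| <= 2 * `|v - w|.
Proof.
have h1 := ler_dist_dist v w; have h2 := ler_dist_dist (v - 1) (w - 1).
have h3 := ler_dist_dist (v + 1) (w + 1).
have e2 : v - 1 - (w - 1) = v - w by ring.
have e3 : v + 1 - (w + 1) = v - w by ring.
rewrite e2 in h2; rewrite e3 in h3; move: h1 h2 h3.
rewrite /hat !ler_norml => /andP[? ?] /andP[? ?] /andP[? ?].
by apply/andP; split; lra.
Qed.

(** The tents are centred at the nodes [k h - M] with half-width [h = d / 2], so two points of one
    support are less than [d] apart. *)
Lemma hat_partition M d : 0 < M -> 0 < d ->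
  exists n (phi : 'I_n -> R -> R), [/\ forall k s, 0 <= phi k s,
    forall s, `|s| <= M -> \sum_k phi k s = 1,
    forall k s t, phi k s != 0 -> phi k t != 0 -> `|s - t| < d,
    forall k, exists2 L : R, 0 < L & forall s t, `|phi k s - phi k t| <= L * `|s - t|
    & forall k, poly_approx M (phi k)].
Proof.
move=> M0 d0; pose h := d / 2; have h0 : 0 < h by rewrite divr_gt0.
pose n := Num.bound (2 * M / h).
pose phi k s := hat ((s + M) / h - k%:R).
exists n.+1, (fun k : 'I_n.+1 => phi k); split.
- by move=> k s; exact: hat_ge0.
- move=> s sM; apply: hat_sum; move: sM; rewrite ler_norml => /andP[? ?].
  rewrite divr_ge0 ?(ltW h0)//=; last by lra.
  apply: le_trans (ltW (archi_boundP _)); last by rewrite divr_ge0 ?(ltW h0)//; lra.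
  by rewrite ler_pM2r ?invr_gt0//; lra.
- move=> k s t /hat_supp + /hat_supp.
  move: (k%:R) => j; rewrite !ltr_norml => /andP[a1 a2] /andP[b1 b2].
  have : `|(s + M) / h - (t + M) / h| < 2 by rewrite ltr_norml; lra.
  rewrite -mulrBl opprD addrACA subrr addr0 normrM [`|h^-1|]gtr0_norm ?invr_gt0//.
  have -> : 2 = d / h by rewrite /h; field; rewrite gt_eqF.
  by rewrite -ltr_norml ltr_pM2r ?invr_gt0.
- move=> k; exists (2 / h); first by rewrite divr_gt0.
  move=> s t; apply: le_trans (hat_lipschitz _ _) _.
  rewrite opprB addrA subrK -mulrBl opprD addrACA subrr addr0 normrM.
  by rewrite [`|h^-1|]gtr0_norm ?invr_gt0// mulrCA mulrC [2 * _]mulrC mulrAC.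
- move=> k; pose a j := j * h - M.
  (* As a function of [s], the tent combines the distances to its node and to the two neighbouring
     nodes, to which [poly_approx_dist] applies. *)
  have phiE s : phi k s = (2 * h)^-1 * `|s - a (k%:R + 1)| +
     ((2 * h)^-1 * `|s - a (k%:R - 1)| + (- h^-1) * `|s - a k%:R|).
    have hE j : h^-1 * `|s - a j| = `|(s + M) / h - j|.
      rewrite -{1}(gtr0_norm (_ : 0 < h^-1)) ?invr_gt0// -normrM; congr `|_|.
      by rewrite /a; field; rewrite gt_eqF.
    rewrite invfM -!mulrA !hE mulNr hE /phi /hat.
    move: ((s + M) / h) (k%:R) => u j.
    have -> : u - (j + 1) = u - j - 1 by ring.
    have -> : u - (j - 1) = u - j + 1 by ring.
    by field.
  have -> : phi k = fun s => (2 * h)^-1 * `|s - a (k%:R + 1)| +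
     ((2 * h)^-1 * `|s - a (k%:R - 1)| + (- h^-1) * `|s - a k%:R|).
    by apply/funext.
  by do !apply: poly_approxD; apply: poly_approxZ; apply: poly_approx_dist (ltW M0).
Qed.

End Approximation.

(** * Continuous functions on the spectrum *)

Section Spectrum.
Variables (R : realType) (E : set R[i]).
Hypothesis E_real : forall z, E z -> z = (complex.Re z)%:C.
Variable M : R.
Hypothesis M_gt0 : 0 < M.
Hypothesis E_bounded : forall z, E z -> rnorm z <= M.
Hypothesis E_closed : forall r : R, ~ E r%:C ->
  exists2 e : R, 0 < e & forall s : R, `|s - r| < e -> ~ E s%:C.
Hypothesis E_neq0 : exists z, E z.
Implicit Types (s t : E) (e d : R).

Definition re_val t : R := complex.Re (set_val t).

Lemma set_val_re t : set_val t = (re_val t)%:C.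
Proof. by apply: E_real; exact: set_valP. Qed.

Lemma dist_re_val s t : rnorm (set_val s - set_val t) = `|re_val s - re_val t|.
Proof. by rewrite !set_val_re -rmorphB rnorm_real. Qed.

Lemma re_val_bounded t : `|re_val t| <= M.
Proof. by rewrite -rnorm_real -set_val_re; apply: E_bounded; exact: set_valP. Qed.

Lemma uniform_continuity (f : E -> R[i]) : continuous f -> forall e, 0 < e ->
  exists2 d : R, 0 < d & forall s t, `|re_val s - re_val t| < d ->
    rnorm (f s - f t) < e.
Proof.
move=> cf e e0; pose A := [set r : R | E r%:C].
have clA : closed A.
  rewrite -[A]setCK; apply: open_closedC; rewrite openE => r /= /E_closed[d d0 hd].
  by apply/nbhs_ballP; exists d => // s; rewrite /ball/= distrC => /hd.
have : compact A.
  apply: (subclosed_compact clA (@segment_compact _ (- M) M)) => r /= Er.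
  rewrite in_itv/= -ler_norml -rnorm_real; exact: E_bounded.
(* Near-covering with the radius [d] as parameter along [0^'+]: an estimate near each [r], valid for
   small [d], yields one [d] for all of [A]. *)
rewrite compact_near_coveringP => cA.
pose P d r := forall s t, re_val s = r -> `|re_val t - r| < d ->
  rnorm (f s - f t) < e.
have [] := cA R (0^'+) P.
  move=> r Ar; pose t0 : E := exist _ r%:C (mem_set Ar).
  have [h h0 hh] := (continuous_rnormP f).1 cf t0 (e / 2) (divr_gt0 e0 (ltr0n _ 2)).
  exists ([set s | `|s - r| < h / 2], [set d | d < h / 2]) => /=.
    split; last by apply: nbhs_right_lt; rewrite divr_gt0.
    apply/nbhs_ballP; exists (h / 2); first by rewrite /= divr_gt0.
    by move=> s; rewrite /ball/= distrC.
  move=> [r' d] /= [r'r dh] s t sr' td.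
  have hs : rnorm (f s - f t0) < e / 2.
    by apply: hh; rewrite dist_re_val sr' (lt_trans r'r)//; lra.
  have ht : rnorm (f t - f t0) < e / 2.
    apply: hh; rewrite dist_re_val [re_val t0]/=.
    by have := ler_distD r' (re_val t) r; lra.
  rewrite (rdistC (f t)) in ht.
  by have := rdistD (f t0) (f s) (f t); lra.
move=> d /= d0 hd; exists (d / 2); first by rewrite divr_gt0.
move=> s t std; have d2 : 0 < d / 2 by rewrite divr_gt0.
apply: (hd (d / 2) _ d2 (re_val s)) => //=.
- by rewrite /ball/= sub0r normrN gtr0_norm//; lra.
- by rewrite /A/= -set_val_re; exact: set_valP.
- by rewrite distrC.
Qed.

Lemma spectrum_partition d : 0 < d -> exists n (phi : 'I_n -> R -> R) (p : 'I_n -> E),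
  [/\ forall k (s : R), 0 <= phi k s,
    forall t, \sum_k phi k (re_val t) = 1,
    forall k t, phi k (re_val t) != 0 -> `|re_val t - re_val (p k)| < d,
    forall k, continuous (fun t => (phi k (re_val t))%:C : R[i])
    & forall k, poly_approx M (phi k)].
Proof.
move=> d0; have [n [phi [phi0 phi1 phid phic phip]]] := hat_partition M_gt0 d0.
have [z Ez] := E_neq0; pose t0 : E := exist _ z (mem_set Ez).
(* The sample point of [phi k] is taken in its support when that support meets [E]; otherwise
   [phi k] vanishes on [E] and the default [t0] is harmless. *)
have hp k : exists t, (exists t', phi k (re_val t') != 0) -> phi k (re_val t) != 0.
  by have [[t' ht']|h] := pselect (exists t', phi k (re_val t') != 0);
    [exists t'|exists t0].
exists n, phi, (fun k => projT1 (cid (hp k))); split=> //.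
- by move=> t; apply: phi1; exact: re_val_bounded.
- move=> k t kt; apply: (phid k) => //; case: cid => t' /= h.
  by apply: h; exists t.
- move=> k; apply/continuous_rnormP => t e e0; have [L L0 hL] := phic k.
  exists (e / L); first exact: divr_gt0.
  move=> s; rewrite dist_re_val -rmorphB rnorm_real ltr_pdivlMr// mulrC.
  exact: le_lt_trans.
Qed.

Lemma partition_approx (n : nat) (phi : 'I_n -> R) (u : 'I_n -> R[i]) (v : R[i]) e :
  (forall k, 0 <= phi k) -> \sum_k phi k = 1 ->
  (forall k, phi k != 0 -> rnorm (u k - v) <= e) ->
  rnorm (\sum_k (phi k)%:C * u k - v) <= e.
Proof.
move=> phi0 phi1 h.
have -> : \sum_k (phi k)%:C * u k - v = \sum_k (phi k)%:C * (u k - v).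
  under [RHS]eq_bigr do rewrite mulrBr.
  by rewrite sumrB -mulr_suml -rmorph_sum phi1 mul1r.
apply: le_trans (rnorm_sum _ _ _) _.
rewrite -[e]mul1r -phi1 mulr_suml; apply: ler_sum => k _.
rewrite rnormM rnorm_real ger0_norm//.
have [->|k0] := eqVneq (phi k) 0; first by rewrite !mul0r.
by rewrite ler_wpM2l// h.
Qed.

(** Half of the error comes from replacing [f] by the combination of its samples with the partition,
    half from replacing each [phi k] by a polynomial; [B] exceeds the sum of the sample norms. *)
Lemma polynomial_density (f : E -> R[i]) : continuous f -> forall e, 0 < e ->
  exists p : {poly R[i]}, forall t, rnorm (p.[set_val t] - f t) <= e.
Proof.
move=> cf e e0; have e2 : 0 < e / 2 by rewrite divr_gt0.
have [d d0 hd] := uniform_continuity cf e2.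
have [n [phi [p [phi0 phi1 phid _ phip]]]] := spectrum_partition d0.
pose B := \sum_k rnorm (f (p k)) + 1.
have B0 : 0 < B by rewrite ltr_wpDl// sumr_ge0// => k _; exact: rnorm_ge0.
have hq k : exists q : {poly R}, forall s : R, `|s| <= M -> `|q.[s] - phi k s| < e / 2 / B.
  by apply: phip; rewrite divr_gt0.
pose q k := projT1 (cid (hq k)).
have qP k (s : R) : `|s| <= M -> `|(q k).[s] - phi k s| < e / 2 / B.
  by rewrite /q; case: cid => ? /= h; exact: h.
exists (\sum_k f (p k) *: map_poly (real_complex R) (q k)) => t.
have hA : rnorm (\sum_k (phi k (re_val t))%:C * f (p k) - f t) <= e / 2.
  apply: partition_approx => // k /phid /= h; apply/ltW/hd.
  by rewrite distrC.
have hB : rnorm ((\sum_k f (p k) *: map_poly (real_complex R) (q k)).[set_val t]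
   - \sum_k (phi k (re_val t))%:C * f (p k)) <= e / 2.
  rewrite horner_sum -sumrB; apply: le_trans (rnorm_sum _ _ _) _.
  apply: (@le_trans _ _ (\sum_k e / 2 / B * rnorm (f (p k)))).
    apply: ler_sum => k _; rewrite hornerZ set_val_re horner_map/= mulrC -mulrBl.
    rewrite -rmorphB rnormM rnorm_real ler_wpM2r ?rnorm_ge0// ltW// qP//.
    exact: re_val_bounded.
  rewrite -mulr_sumr -mulrA ler_piMr ?(ltW e2)// mulrC ler_pdivrMr// mul1r.
  by rewrite /B lerDl.
apply: le_trans (rdistD _ _ _) _.
by rewrite [leRHS]splitr; apply: lerD; [exact: hB|exact: hA].
Qed.

(** [f] is within [1] of a polynomial, which its coefficients bound on [|s| <= M]. *)
Lemma continuous_bounded (f : E -> R[i]) : continuous f ->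
  exists2 B : R, 0 < B & forall t, rnorm (f t) <= B.
Proof.
move=> cf; have [p hp] := polynomial_density cf ltr01.
exists (\sum_(i < size p) rnorm p`_i * M ^+ i + 1).
  rewrite ltr_wpDl// sumr_ge0// => i _.
  by rewrite mulr_ge0 ?rnorm_ge0// exprn_ge0// ltW.
move=> t; have := rdistD p.[set_val t] (f t) 0; rewrite !subr0 => /le_trans; apply.
rewrite addrC lerD//; last by rewrite rdistC.
rewrite horner_coef; apply: le_trans (rnorm_sum _ _ _) _.
apply: ler_sum => i _; rewrite rnormM ler_wpM2l ?rnorm_ge0//.
rewrite set_val_re -rmorphXn rnorm_real normrX lerXn2r ?nnegrE ?(ltW M_gt0)//.
exact: re_val_bounded.
Qed.

End Spectrum.

(** * Existence of the continuous functional calculus *)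

Section FunctionalCalculus.
Variables (R : realType) (K : completeNormedModType R[i]).
Variable ip : {dot K for Num.conj}.
Hypothesis K_hilbert : hilbert_norm ip.
Hypothesis K_neq0 : exists x : K, x != 0.
Variables (D : K -> K) (D_bounded : bounded_operator D).
Hypothesis D_sa : self_adjoint ip D.
Local Notation peval := (poly_op D).
Local Notation sp := (spectrum D).
Implicit Types (p q : {poly R[i]}) (x y : K) (e : R) (f g h : sp -> R[i]).

Lemma spectrum_dense f : continuous f -> forall e, 0 < e ->
  exists p, forall t, rnorm (p.[set_val t] - f t) <= e.
Proof.
have [M M0 hM] := spectrum_bounded K_hilbert D_bounded D_sa.
apply: (@polynomial_density R sp _ M M0 hM).
- by move=> z; exact: spectrum_Re.
- by move=> r; exact: spectrum_closed.
- exact: (spectrum_nonempty K_hilbert).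
Qed.

Lemma spectrum_continuous_bounded f : continuous f ->
  exists2 B : R, 0 < B & forall t, rnorm (f t) <= B.
Proof.
have [M M0 hM] := spectrum_bounded K_hilbert D_bounded D_sa.
apply: (@continuous_bounded R sp _ M M0 hM).
- by move=> z; exact: spectrum_Re.
- by move=> r; exact: spectrum_closed.
- exact: (spectrum_nonempty K_hilbert).
Qed.

Lemma peval_norm_le_val p e : 0 <= e ->
  (forall t : sp, rnorm p.[set_val t] <= e) ->
  forall x, rnorm (peval p x) <= e * rnorm x.
Proof.
move=> e0 h; apply: (peval_norm_le K_hilbert K_neq0 D_bounded D_sa e0) => z zD.
exact: h (exist _ z (mem_set zD)).
Qed.

(** This pins [T] down as [f(D)] against every polynomial approximant at once instead of one
    sequence, so each law below may choose the approximants that suit it. *)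
Definition calculus_op f (T : K -> K) := forall p e, 0 < e ->
  (forall t, rnorm (p.[set_val t] - f t) <= e) ->
  forall x, rnorm (T x - peval p x) <= e * rnorm x.

(** Restricting to [e <= 1] serves the product law, where approximants of [f] must be bounded
    independently of [e]. *)
Lemma eq_of_small (C : R) x y :
  (forall e, 0 < e -> e <= 1 -> rnorm (x - y) <= e * C) -> x = y.
Proof.
move=> h; apply/eqP; rewrite -subr_eq0 -rnorm_eq0 eq_le rnorm_ge0 andbT.
rewrite leNgt; apply/negP => xy0; have C0 : 0 < C.
  by have := h 1 ltr01 (lexx _); rewrite mul1r; apply: lt_le_trans.
pose m := Num.min 1 (rnorm (x - y) / (2 * C)).
have m0 : 0 < m by rewrite lt_min ltr01/= divr_gt0// mulr_gt0.
have := h m m0; rewrite ge_min lexx => /(_ isT).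
have : m * C <= rnorm (x - y) / 2.
  apply: (@le_trans _ _ (rnorm (x - y) / (2 * C) * C)).
    by rewrite ler_pM2r// ge_min lexx orbT.
  by rewrite invfM mulrA mulfVK// gt_eqF.
lra.
Qed.

Lemma calculus_op_ex f : continuous f -> exists T, calculus_op f T.
Proof.
move=> cf; have v0 n : 0 < (n.+1%:R)^-1 :> R by rewrite invr_gt0 ltr0n.
have hp n := cid (spectrum_dense cf (v0 n)).
pose p n := projT1 (hp n).
have pP n (t : sp) : rnorm ((p n).[set_val t] - f t) <= n.+1%:R^-1.
  by rewrite /p; case: (hp n) => ? /= h; exact: h.
(* This comparison with an arbitrary approximant gives both the Cauchy property (with [q] another
   [p n]) and the specification of the limit. *)
have close n q e x : 0 < e -> (forall t, rnorm (q.[set_val t] - f t) <= e) ->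
    rnorm (peval (p n) x - peval q x) <= (n.+1%:R^-1 + e) * rnorm x.
  move=> e0 hq; rewrite -pevalB; apply: peval_norm_le_val.
    by rewrite addr_ge0// ltW.
  move=> t; rewrite hornerD hornerN; apply: le_trans (rdistD (f t) _ _) _.
  by rewrite lerD// rdistC.
have small (e : R) : 0 < e -> exists N, forall n, (N <= n)%N -> n.+1%:R^-1 < e.
  move=> e0; exists (Num.bound e^-1) => n Nn.
  rewrite invf_plt ?posrE ?ltr0n// (lt_le_trans (archi_boundP _)) ?invr_ge0 ?ltW//.
  by rewrite ltr_nat ltnS.
have lim x : exists l, forall e, 0 < e ->
    exists N, forall n, (N <= n)%N -> rnorm (peval (p n) x - l) < e.
  apply: rnorm_complete => e e0; have x1 : 0 < rnorm x + 1 by rewrite ltr_wpDl ?rnorm_ge0.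
  have [|N hN] := small (e / (rnorm x + 1) / 2); first by rewrite !divr_gt0.
  exists N => m n Nm Nn.
  apply: le_lt_trans (close m (p n) n.+1%:R^-1 x (v0 n) (pP n)) _.
  apply: (@le_lt_trans _ _ ((m.+1%:R^-1 + n.+1%:R^-1) * (rnorm x + 1))).
    by rewrite ler_pM2l// lerDl.
  by rewrite -ltr_pdivlMr// [ltRHS]splitr ltrD ?hN.
exists (fun x => projT1 (cid (lim x))) => q e e0 hq x.
case: cid => l /= hl; apply/ler_addgt0Pr => d d0.
have x1 : 0 < rnorm x + 1 by rewrite ltr_wpDl ?rnorm_ge0.
have [|N hN] := small (d / 2 / (rnorm x + 1)); first by rewrite !divr_gt0.
have [|N' hN'] := hl (d / 2); first by rewrite divr_gt0.
pose n := maxn N N'.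
have h1 := hN' n (leq_maxr _ _); have h2 := hN n (leq_maxl _ _).
have h3 := close n q e x e0 hq.
have h4 : n.+1%:R^-1 * rnorm x <= d / 2.
  apply: (@le_trans _ _ (n.+1%:R^-1 * (rnorm x + 1))).
    by rewrite ler_wpM2l ?lerDl// ltW.
  by rewrite -ler_pdivlMr// ltW.
have := rdistD (peval (p n) x) l (peval q x); rewrite (rdistC l (peval (p n) x)).
rewrite mulrDl in h3; move: h1 h3 h4; move: (n.+1%:R^-1 * rnorm x) => v; lra.
Qed.

Lemma calculus_op_bounded f T : continuous f -> calculus_op f T -> bounded_operator T.
Proof.
move=> cf hT; apply/boundedP; split.
  move=> a x y; pose C := rnorm (a *: x + y) + rnorm a * rnorm x + rnorm y.
  apply: (@eq_of_small C) => e e0 _; have [p hp] := spectrum_dense cf e0.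
  have [lp _] := bounded_peval D_bounded p.
  have h u := hT p e e0 hp u.
  apply: le_trans (rdistD (peval p (a *: x + y)) _ _) _.
  rewrite /C -!addrA mulrDr; apply: lerD; first exact: h.
  rewrite lp.
  have -> : a *: peval p x + peval p y - (a *: T x + T y) =
      a *: (peval p x - T x) + (peval p y - T y).
    by rewrite scalerBr opprD addrACA.
  apply: le_trans (rnormD _ _) _; rewrite mulrDr rnormZ.
  rewrite mulrCA; apply: lerD; last by rewrite rdistC.
  by rewrite ler_wpM2l ?rnorm_ge0// rdistC.
have [p hp] := spectrum_dense cf ltr01.
have /boundedP[_ [M M0 hM]] := bounded_peval D_bounded p.
exists (1 + M); first by rewrite addr_gt0.
move=> x; have := rdistD (peval p x) (T x) 0; rewrite !subr0.
by have := hT p 1 ltr01 hp x; have := hM x; rewrite mulrDl; lra.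
Qed.

Lemma calculus_op_add f g h F G H : continuous f -> continuous g ->
  (forall t, h t = f t + g t) ->
  calculus_op f F -> calculus_op g G -> calculus_op h H ->
  forall x, H x = F x + G x.
Proof.
move=> cf cg hE hF hG hH x; apply: (@eq_of_small (4 * rnorm x)) => e e0 _.
have [p hp] := spectrum_dense cf e0; have [q hq] := spectrum_dense cg e0.
have h1 := hF p e e0 hp x; have h2 := hG q e e0 hq x.
have h3 : rnorm (H x - peval (p + q) x) <= (e + e) * rnorm x.
  apply: hH => [|t]; first exact: addr_gt0.
  rewrite hE hornerD opprD addrACA; apply: le_trans (rnormD _ _) _.
  exact: lerD.
apply: le_trans (rdistD (peval (p + q) x) _ _) _.
have -> : peval (p + q) x - (F x + G x) =
    (peval p x - F x) + (peval q x - G x) by rewrite pevalD opprD addrACA.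
have := rnormD (peval p x - F x) (peval q x - G x).
by rewrite (rdistC _ (F x)) (rdistC _ (G x)); rewrite mulrDl in h3; lra.
Qed.

Lemma calculus_op_scale (a : R[i]) f h F H : continuous f ->
  (forall t, h t = a * f t) -> calculus_op f F -> calculus_op h H ->
  forall x, H x = a *: F x.
Proof.
move=> cf hE hF hH x; pose b := rnorm a + 1.
have b0 : 0 < b by rewrite ltr_wpDl ?rnorm_ge0.
apply: (@eq_of_small ((b + rnorm a) * rnorm x)) => e e0 _.
have [p hp] := spectrum_dense cf e0.
have h1 := hF p e e0 hp x.
have h3 : rnorm (H x - peval (a *: p) x) <= (b * e) * rnorm x.
  apply: hH => [|t]; first exact: mulr_gt0.
  rewrite hE hornerZ -mulrBr rnormM; apply: ler_pM; rewrite ?rnorm_ge0//.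
  by rewrite lerDl.
apply: le_trans (rdistD (peval (a *: p) x) _ _) _.
rewrite pevalZ in h3 *; rewrite -scalerBr rnormZ (rdistC _ (F x)).
have : rnorm a * rnorm (F x - peval p x) <= rnorm a * (e * rnorm x).
  by rewrite ler_wpM2l ?rnorm_ge0.
by move: h3; lra.
Qed.

Lemma calculus_op_mul f g h F G H : continuous f -> continuous g ->
  (forall t, h t = f t * g t) ->
  calculus_op f F -> calculus_op g G -> calculus_op h H ->
  forall x, H x = F (G x).
Proof.
move=> cf cg hE hF hG hH x.
have [A A0 hA] := spectrum_continuous_bounded cf.
have [B B0 hB] := spectrum_continuous_bounded cg.
(* Up to the factor [e], the summands bound the distances from [H x] to [p(D) (q(D) x)], from there
   to [p(D) (G x)], and from there to [F (G x)]. *)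
pose C := (A + 1 + B) * rnorm x + ((A + 1) * rnorm x + rnorm (G x)).
apply: (@eq_of_small C) => e e0 e1.
have [p hp] := spectrum_dense cf e0; have [q hq] := spectrum_dense cg e0.
have pA (t : sp) : rnorm p.[set_val t] <= A + 1.
  have := rdistD (f t) p.[set_val t] 0; rewrite !subr0.
  by have := hp t; have := hA t; lra.
have h1 : rnorm (H x - peval (p * q) x) <= ((A + 1 + B) * e) * rnorm x.
  apply: hH => [|t]; first by rewrite mulr_gt0// !addr_gt0.
  have -> : (p * q).[set_val t] - h t =
    p.[set_val t] * (q.[set_val t] - g t) + (p.[set_val t] - f t) * g t.
    by rewrite hE hornerM; ring.
  apply: le_trans (rnormD _ _) _; rewrite !rnormM mulrDl; apply: lerD.
    by apply: ler_pM; rewrite ?rnorm_ge0.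
  by rewrite mulrC; apply: ler_pM; rewrite ?rnorm_ge0.
have h2 : rnorm (peval p (peval q x) - peval p (G x)) <= (A + 1) * (e * rnorm x).
  have [lp _] := bounded_peval D_bounded p; rewrite -linB//.
  apply: le_trans (peval_norm_le_val _ pA _) _; first by rewrite addr_ge0// ltW.
  by rewrite ler_wpM2l ?addr_ge0 ?(ltW A0)// rdistC hG.
have h3 : rnorm (peval p (G x) - F (G x)) <= e * rnorm (G x).
  by rewrite rdistC hF.
have := rdistD (peval (p * q) x) (H x) (F (G x)).
have := rdistD (peval p (G x)) (peval (p * q) x) (F (G x)).
rewrite [peval (p * q) x](pevalM D_bounded.1) in h1 *.
by rewrite /C; lra.
Qed.

(** On the real spectrum [conjp p] approximates the conjugate of [f] as well as [p] approximates
    [f], so the identity passes from polynomials to the limit. *)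
Lemma calculus_op_conj f h F H : continuous f -> (forall t, h t = (f t)^*) ->
  calculus_op f F -> calculus_op h H -> adjoint_of ip F H.
Proof.
move=> cf hE hF hH x y; apply: (@subr0_eq).
apply/eqP; rewrite -rnorm_eq0 eq_le rnorm_ge0 andbT.
apply/ler_addgt0Pr => d d0; rewrite add0r.
pose b := rnorm x * rnorm y; have b0 : 0 <= b by rewrite mulr_ge0 ?rnorm_ge0.
pose e := d / 2 / (b + 1).
have b1 : 0 < b + 1 by rewrite ltr_wpDl.
have e0 : 0 < e by rewrite !divr_gt0.
have eb : e * b <= d / 2.
  apply: (@le_trans _ _ (e * (b + 1))); first by rewrite ler_wpM2l ?(ltW e0)// lerDl.
  by rewrite /e mulfVK// gt_eqF.
have [p hp] := spectrum_dense cf e0.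
have h1 := hF p e e0 hp x.
have h2 : rnorm (H y - peval (conjp p) y) <= e * rnorm y.
  apply: hH => // t; rewrite hE (horner_conjp K_hilbert D_bounded D_sa); last exact: set_valP.
  by rewrite -rmorphB rnorm_conj.
have -> : ip (F x) y - ip x (H y) =
    ip (F x - peval p x) y - ip x (H y - peval (conjp p) y).
  rewrite ipDl ipNl ipDr ipNr (adjoint_peval D_bounded D_sa); ring.
have h3 : rnorm (ip (F x - peval p x) y) <= e * b.
  rewrite (le_trans (ip_le K_hilbert _ _))// /b mulrA.
  by rewrite ler_wpM2r ?rnorm_ge0.
have h4 : rnorm (ip x (H y - peval (conjp p) y)) <= e * b.
  rewrite (le_trans (ip_le K_hilbert _ _))// /b mulrCA.
  by rewrite ler_wpM2l ?rnorm_ge0.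
apply: le_trans (rnormD _ _) _; rewrite rnormN; lra.
Qed.

Lemma calculus_op_poly p h H : (forall t, h t = p.[set_val t]) ->
  calculus_op h H -> forall x, H x = peval p x.
Proof.
move=> hE hH x; apply: (@eq_of_small (rnorm x)) => e e0 _; apply: hH => // t.
by rewrite hE subrr rnorm0 ltW.
Qed.

Lemma functional_calculus_ex :
  exists Phi, @is_functional_calculus R K ip D Phi.
Proof.
have ex (f : continuousType sp R[i]) : exists T, calculus_op f T.
  by apply: calculus_op_ex; exact: cts_fun.
pose Phi (f : continuousType sp R[i]) := projT1 (cid (ex f)).
have PhiP (f : continuousType sp R[i]) : calculus_op f (Phi f) by rewrite /Phi; case: cid.
have c (f : continuousType sp R[i]) : continuous f by exact: cts_fun.
exists Phi; split.
- by move=> f; exact: calculus_op_bounded (c f) (PhiP f).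
- by move=> f g h hE; exact: calculus_op_add (c f) (c g) hE _ _ _.
- by move=> a f h hE; exact: calculus_op_scale (c f) hE _ _.
- by move=> f g h hE; exact: calculus_op_mul (c f) (c g) hE _ _ _.
- by move=> f h hE; exact: calculus_op_conj (c f) hE _ _.
- move=> h hE x; rewrite (@calculus_op_poly 1%:P h (Phi h))//.
    by rewrite pevalC scale1r.
  by move=> t; rewrite hornerC hE.
- move=> h hE x; rewrite (@calculus_op_poly 'X h (Phi h))//.
    by rewrite (pevalX D_bounded.1).
  by move=> t; rewrite hornerX hE.
Qed.

(** Existence rules out the default value of [xget]. *)
Lemma cfcP : @is_functional_calculus R K ip D (cfc ip (D := D)).
Proof.
have [Phi hPhi] := functional_calculus_ex.
exact: (xgetPex (fun _ _ => 0) (ex_intro _ Phi hPhi)).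
Qed.

End FunctionalCalculus.

(** * Convexity and the Toeplitz-Hausdorff theorem *)

Section Convexity.
Variable R : realType.
Implicit Types (C : set R[i]) (z w : R[i]) (a b l : R).

Lemma convexP C : @convex_set R[i] R[i]^o C <->
  forall z w l, 0 <= l <= 1 -> C z -> C w -> C (l%:C * z + (1 - l)%:C * w).
Proof.
split=> [cC z w l /andP[l0 l1] Cz Cw|h x y l /set_mem Cx /set_mem Cy].
  have l0' : 0 <= l%:C :> R[i] by rewrite ler0c.
  have l1' : l%:C <= 1 :> R[i] by rewrite -(rmorph1 (real_complex R)) lecR.
  have /set_mem := cC z w (Itv01 l0' l1') (mem_set Cz) (mem_set Cw).
  by rewrite rmorphB rmorph1.
apply: mem_set.
have l0 : 0 <= l%:num by [].
have l1 : l%:num <= 1 by [].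
have lr : l%:num = (complex.Re l%:num)%:C by rewrite RRe_real// ger0_real.
have hl : 0 <= complex.Re l%:num <= 1 by rewrite -!lecR -lr l0 l1.
have := h x y _ hl Cx Cy.
by rewrite (rmorphB (real_complex R)) (rmorph1 (real_complex R)) /= -!lr.
Qed.

Lemma conv_hull_convex C : @convex_set R[i] R[i]^o (conv_hull C).
Proof.
apply/convexP => z w l l01 Cz Cw B [cB CB].
by move/convexP: (cB); apply=> //; [apply: Cz|apply: Cw].
Qed.

Lemma closure_convex C : @convex_set R[i] R[i]^o C ->
  @convex_set R[i] R[i]^o (closure C).
Proof.
move=> /convexP cC; apply/convexP => z w l l01.
move=> /closure_rnormP cz /closure_rnormP cw; apply/closure_rnormP => e e0.
have [z' Cz' zz'] := cz e e0; have [w' Cw' ww'] := cw e e0.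
exists (l%:C * z' + (1 - l)%:C * w'); first exact: cC.
rewrite opprD addrACA -!mulrBr; apply: le_lt_trans (rnormD _ _) _.
rewrite !rnormM !rnorm_real; case/andP: l01 => l0 l1.
rewrite ger0_norm// ger0_norm ?subr_ge0//.
have [->|lN0] := eqVneq l 0; first by rewrite mul0r add0r subr0 mul1r.
have l0' : 0 < l by rewrite lt_def lN0.
have h1 : l * rnorm (z' - z) < l * e by rewrite ltr_pM2l.
have h2 : (1 - l) * rnorm (w' - w) <= (1 - l) * e.
  by rewrite ler_wpM2l ?subr_ge0// ltW.
lra.
Qed.

(* [cone_over C a z]: the point [(a, z)] lies in the cone spanned by [1 * C]. *)
Definition cone_over C a z := 0 <= a /\ exists2 w, C w & z = a%:C * w.

(** Convexity in homogeneous form, with weights [a / (a + b)] and [b / (a + b)]; if [a + b = 0],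
    both points are [0]. *)
Lemma cone_overD C a b z w : @convex_set R[i] R[i]^o C ->
  cone_over C a z -> cone_over C b w -> cone_over C (a + b) (z + w).
Proof.
move=> /convexP cC [a0 [z' Cz' ->]] [b0 [w' Cw' ->]].
split; first exact: addr_ge0.
have [ab0|ab0] := eqVneq (a + b) 0.
  exists z' => //; have [-> ->] : a = 0 /\ b = 0 by split; lra.
  by rewrite addr0 !mul0r addr0.
have ab : 0 < a + b by rewrite lt_def ab0 addr_ge0.
exists ((a / (a + b))%:C * z' + (1 - a / (a + b))%:C * w').
  apply: cC => //; rewrite divr_ge0 ?(ltW ab)//= ler_pdivrMr// mul1r lerDl//.
have -> : 1 - a / (a + b) = b / (a + b) by field.
by rewrite mulrDr !mulrA -!rmorphM/= ![(a + b) * (_ / _)]mulrC !mulfVK.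
Qed.

Lemma cone_over_sum C (I : Type) (r : seq I) (a : I -> R) (z : I -> R[i]) :
  C !=set0 -> @convex_set R[i] R[i]^o C ->
  (forall i, cone_over C (a i) (z i)) ->
  cone_over C (\sum_(i <- r) a i) (\sum_(i <- r) z i).
Proof.
move=> [w Cw] cC h; elim: r => [|i r ih].
  by rewrite !big_nil; split=> //; exists w => //; rewrite mul0r.
by rewrite !big_cons; apply: cone_overD.
Qed.

End Convexity.

Section ToeplitzHausdorff.
Variables (R : realType) (V : lmodType R[i]) (ip : V -> V -> R[i]).
Hypothesis ipDl : forall x y z, ip (x + y) z = ip x z + ip y z.
Hypothesis ipZl : forall a x z, ip (a *: x) z = a * ip x z.
Hypothesis ipC : forall x y, ip x y = (ip y x)^*.
Hypothesis ip_gt0 : forall x, x != 0 -> 0 < ip x x.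
Variable T : V -> V.
Hypothesis T_linear : linear T.

Let ipDr x y z : ip x (y + z) = ip x y + ip x z.
Proof. by rewrite ipC ipDl rmorphD /= -!ipC. Qed.

Let ipZr a x y : ip x (a *: y) = a^* * ip x y.
Proof. by rewrite ipC ipZl rmorphM /= -!ipC. Qed.

Let TD x y : T (x + y) = T x + T y.
Proof. by have := T_linear 1 x y; rewrite !scale1r. Qed.

Let T0 : T 0 = 0.
Proof. by apply/(addrI (T 0)); rewrite -TD !addr0. Qed.

Let TZ a x : T (a *: x) = a *: T x.
Proof. by have := T_linear a x 0; rewrite T0 !addr0. Qed.

(** Homogeneous form: the Rayleigh quotient of any nonzero vector counts, which spares the
    normalization. *)
Lemma numrangeP (z : R[i]) :
  numrange ip T z <-> exists2 x, x != 0 & ip (T x) x = z * ip x x.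
Proof.
split=> [[x nx ->]|[x x0 xz]].
  have x1 : ip x x = 1 by rewrite -[LHS]sqrtCK -/(ipnorm ip x) nx expr1n.
  exists x; last by rewrite x1 mulr1.
  by apply/eqP => x0; move: x1; rewrite x0 -(scale0r 0) ipZl mul0r => /eqP;
    rewrite eq_sym oner_eq0.
have n0 := ip_gt0 x0; have s0 : 0 < ipnorm ip x by rewrite sqrtC_gt0.
have sJ : ((ipnorm ip x)^-1)^* = (ipnorm ip x)^-1.
  by rewrite conj_Creal// ger0_real// invr_ge0 ltW.
have ss : (ipnorm ip x)^-1 * ((ipnorm ip x)^-1 * ip x x) = 1.
  rewrite -[X in _ * (_ * X)]sqrtCK -/(ipnorm ip x); field.
  by rewrite gt_eqF.
exists ((ipnorm ip x)^-1 *: x).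
  by rewrite /ipnorm ipZl ipZr sJ ss sqrtC1.
by rewrite TZ ipZl ipZr sJ xz -[LHS]mulr1 -ss; ring.
Qed.

(** The imaginary part equals that of [m r] with [r] the difference of [p] and the conjugate of [q];
    take for [m] the conjugate of [r / |r|], so that [m r = |r|]. *)
Lemma unimodular_real (p q : R[i]) : exists2 m : R[i], m * m^* = 1 &
  complex.Im (m * p + m^* * q) = 0.
Proof.
pose r := p - q^*; have [r0|r0] := eqVneq r 0.
  exists 1; rewrite ?conjC1 ?mul1r//; move: r0; rewrite /r.
  by case: (p) (q) => [a b] [c d] /eqP; rewrite eq_complex /= => /andP[_ /eqP]; lra.
have n0 : rnorm r != 0 by rewrite rnorm_eq0.
exists (r^* * ((rnorm r)^-1)%:C).
  rewrite rmorphM/= conjCK.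
  have -> : (((rnorm r)^-1)%:C)^* = ((rnorm r)^-1)%:C :> R[i] by exact: conjc_real.
  rewrite mulrACA [r^* * r]mulrC mul_conj_rnorm -!rmorphM.
  by rewrite -[RHS](rmorph1 (real_complex R)); congr (_%:C); field.
move: (rnorm r)^-1 => k; rewrite /r; case: (p) (q) => [a b] [c d] /=; ring.
Qed.

Lemma quadratic_root (l c : R) : 0 < l < 1 ->
  exists s : R, (1 - l) * s ^+ 2 + c * s - l = 0.
Proof.
move=> /andP[l0 l1]; pose D := c ^+ 2 + 4 * (1 - l) * l.
have D0 : 0 <= D by rewrite addr_ge0 ?sqr_ge0// !mulr_ge0// ?subr_ge0 ltW.
exists ((Num.sqrt D - c) / (2 * (1 - l))).
have l2 : 1 - l != 0 by rewrite subr_eq0 gt_eqF.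
have DE := sqr_sqrtr D0; move: (Num.sqrt D) DE => s sD.
have -> : (1 - l) * ((s - c) / (2 * (1 - l))) ^+ 2 + c * ((s - c) / (2 * (1 - l))) - l
  = (s ^+ 2 - (c ^+ 2 + 4 * (1 - l) * l)) / (4 * (1 - l)) by field.
by rewrite sD /D subrr mul0r.
Qed.

(** For [S = (T - b) / (a - b)] the form is [1] at [x] and [0] at [y]. At [v = s m x + y], with [m]
    making the cross terms real, it is [s^2 + s c], while [ip v v = s^2 + s d + 1]. The quotient is
    [l] exactly when [(1 - l) s^2 + (c - l d) s - l = 0], which has a real root. *)
Lemma toeplitz_hausdorff : @convex_set R[i] R[i]^o (numrange ip T).
Proof.
apply/convexP => a b l /andP[l0 l1] Wa Wb.
have [->|ln0] := eqVneq l 0; first by rewrite mul0r add0r subr0 mul1r.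
have [->|ln1] := eqVneq l 1; first by rewrite subrr mul0r addr0 mul1r.
have [->|ab] := eqVneq a b.
  by rewrite -mulrDl -rmorphD addrC subrK mul1r.
have ab0 : a - b != 0 by rewrite subr_eq0.
case: Wa => x nx ax; case: Wb => y ny yb.
have xx : ip x x = 1 by rewrite -[LHS]sqrtCK -/(ipnorm ip x) nx expr1n.
have yy : ip y y = 1 by rewrite -[LHS]sqrtCK -/(ipnorm ip y) ny expr1n.
pose P := (ip (T x) y - b * ip x y) / (a - b).
pose Q := (ip (T y) x - b * ip y x) / (a - b).
have [m mm Imm] := unimodular_real P Q.
pose c := complex.Re (m * P + m^* * Q).
have cE : m * P + m^* * Q = c%:C by rewrite [LHS]complexE Imm mulr0 addr0.
pose d := 2 * complex.Re (m * ip x y).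
have dE : m * ip x y + m^* * ip y x = d%:C.
  rewrite (ipC y) -rmorphM /d [RHS]rmorphM rmorph_nat; exact: addcJ.
clearbody c d.
have l01 : 0 < l < 1 by rewrite !lt_def ln0 l0 l1 eq_sym ln1.
have [s hs] := quadratic_root (c - l * d) l01.
apply/numrangeP; exists ((s%:C * m) *: x + y).
  (* If the vector vanished, [y] would be a multiple of [x], both unit vectors, and [a = b]. *)
  apply/eqP => /eqP; rewrite addr_eq0 => /eqP xy; move: ab; rewrite ax yb.
  have sJ : (s%:C)^* = s%:C :> R[i] by exact: conjc_real.
  have : ip ((s%:C * m) *: x) ((s%:C * m) *: x) = 1.
    by rewrite xy -scaleN1r ipZl ipZr rmorphN1 yy mulr1 mulrN1 opprK.
  have : ip (T ((s%:C * m) *: x)) ((s%:C * m) *: x) = b.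
    by rewrite xy -scaleN1r TZ ipZl ipZr rmorphN1 -yb mulN1r mulN1r opprK.
  rewrite TZ !ipZl !ipZr xx -ax mulr1 -yb mulrA => <- ->.
  by rewrite mul1r eqxx.
have sJ : (s%:C)^* = s%:C :> R[i] by exact: conjc_real.
have m0 : m != 0.
  by apply/eqP => m0; move: mm => /eqP; rewrite m0 mul0r eq_sym oner_eq0.
have mJ : m^* = m^-1 by apply: (mulfI m0); rewrite mm mulfV.
have -> : ip ((s%:C * m) *: x + y) ((s%:C * m) *: x + y) =
    (s ^+ 2 + s * d + 1)%:C.
  rewrite !(ipDl, ipDr, ipZl, ipZr) xx yy rmorphM /= sJ !rmorphD !rmorphM/= -dE.
  by rewrite mJ; field.
have -> : ip (T ((s%:C * m) *: x + y)) ((s%:C * m) *: x + y) =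
    (a - b) * (s ^+ 2 + s * c)%:C + b * (s ^+ 2 + s * d + 1)%:C.
  rewrite TD TZ !(ipDl, ipDr, ipZl, ipZr) -ax -yb [((_ * _)^*)%R]rmorphM /= sJ
    !rmorphD !rmorphM/= -dE -cE /P /Q.
  rewrite mJ; field.
  by rewrite m0 ab0.
have -> : s ^+ 2 + s * c = l * (s ^+ 2 + s * d + 1) by rewrite /= in hs; lra.
rewrite !rmorphM !rmorphB /= rmorph1; ring.
Qed.

End ToeplitzHausdorff.

(** * Positivity of the functional calculus *)

Section ContinuousFunctions.
Variables (R : realType) (E : set R[i]).
Implicit Types (f g : E -> R[i]).

Lemma continuous_set_val : continuous (set_val : E -> R[i]).
Proof. exact: initial_continuous. Qed.

Lemma continuous_add f g : continuous f -> continuous g ->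
  continuous (fun t => f t + g t).
Proof. by move=> cf cg t; exact: (continuousD (cf t) (cg t)). Qed.

Lemma continuous_mul f g : continuous f -> continuous g ->
  continuous (fun t => f t * g t).
Proof. by move=> cf cg t; exact: (continuousM (cf t) (cg t)). Qed.

Lemma continuous_cst (a : R[i]) : continuous (fun _ : E => a).
Proof. exact: cst_continuous. Qed.

Lemma continuous_conj f : continuous f -> continuous (fun t => (f t)^*).
Proof.
move=> /continuous_rnormP cf; apply/continuous_rnormP => t e e0.
have [d d0 hd] := cf t e e0; exists d => // s /hd.
by rewrite -rmorphB rnorm_conj.
Qed.

(** For nonnegative reals the squared difference of the roots is at most the difference of the
    numbers, so the radius for [e ^+ 2] serves for [e]. *)
Lemma continuous_sqrt (w : E -> R) : (forall t, 0 <= w t) ->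
  continuous (fun t => (w t)%:C : R[i]) ->
  continuous (fun t => (Num.sqrt (w t))%:C : R[i]).
Proof.
move=> w0 /continuous_rnormP cw; apply/continuous_rnormP => t e e0.
have [d d0 hd] := cw t (e ^+ 2) (exprn_gt0 2 e0); exists d => // s /hd.
rewrite -!rmorphB !rnorm_real => h.
rewrite -(ltr_pXn2r (isT : (0 < 2)%N)) ?nnegrE ?(ltW e0)//.
apply: le_lt_trans h.
rewrite -{2}(sqr_sqrtr (w0 s)) -{2}(sqr_sqrtr (w0 t)).
move: (Num.sqrt (w s)) (sqrtr_ge0 (w s)) (Num.sqrt (w t)) (sqrtr_ge0 (w t)).
move=> a a0 b b0; rewrite subr_sqr normrM expr2.
by rewrite ler_wpM2l// (le_trans (ler_normB _ _))// !ger0_norm// addr_ge0.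
Qed.

End ContinuousFunctions.

Section CalculusConsequences.
Variables (R : realType) (K : completeNormedModType R[i]).
Variable ip : {dot K for Num.conj}.
Hypothesis K_hilbert : hilbert_norm ip.
Variables (D : K -> K) (D_bounded : bounded_operator D).
Hypothesis D_sa : self_adjoint ip D.
Local Notation sp := (spectrum D).
Local Notation C_sp := (continuousType sp R[i]).
Variable Phi : C_sp -> K -> K.
Hypothesis PhiP : is_functional_calculus ip Phi.
Local Notation rip := (re_ip ip).
Implicit Types (f g h : C_sp) (x : K).

Let c f : continuous f. Proof. exact: cts_fun. Qed.

(** [k] is the square root of [w]; being real, it gives a self-adjoint [Phi k] with
    [Phi f = Phi k \o Phi k]. The factored form also yields Gram matrices. *)
Lemma calculus_ge0 f (w : sp -> R) : (forall t, 0 <= w t) ->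
  (forall t, f t = (w t)%:C) ->
  exists k : C_sp, forall x y, ip (Phi f x) y = ip (Phi k x) (Phi k y).
Proof.
move=> w0 fw.
have cw : continuous (fun t => (w t)%:C : R[i]).
  have -> : (fun t => (w t)%:C) = (f : sp -> R[i]) by apply/funext => t; rewrite fw.
  exact: c.
have [k kE] := mkcts_ex (continuous_sqrt w0 cw); exists k => x y.
rewrite -(fc_conj PhiP (f := k)); last first.
  by move=> t; rewrite kE; exact: esym (conjc_real _).
rewrite (fc_mul PhiP (f := k) (g := k))// => t.
by rewrite fw kE -rmorphM -expr2 sqr_sqrtr.
Qed.

Lemma continuous_lincomb (I : Type) (r : seq I) (a : I -> R[i]) (F : I -> C_sp) :
  continuous (fun t => \sum_(i <- r) a i * F i t).
Proof.
elim: r => [|j r ih].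
  under eq_fun do rewrite big_nil.
  exact: continuous_cst.
under eq_fun do rewrite big_cons.
exact (continuous_add (continuous_mul (@continuous_cst R sp (a j)) (@c (F j))) ih).
Qed.

Lemma calculus_sum (I : Type) (r : seq I) (a : I -> R[i]) (F : I -> C_sp) f :
  (forall t, f t = \sum_(i <- r) a i * F i t) ->
  forall x, Phi f x = \sum_(i <- r) a i *: Phi (F i) x.
Proof.
elim: r f => [|i r ih] f fE x.
  rewrite big_nil (fc_scale PhiP (a := 0) (f := f)) ?scale0r// => t.
  by rewrite fE big_nil mul0r.
have [g gE] := mkcts_ex (@continuous_lincomb _ r a F).
have [k kE] := mkcts_ex (continuous_mul (@continuous_cst R sp (a i)) (@c (F i))).
rewrite big_cons -(ih _ gE) -(fc_scale PhiP kE) (fc_add PhiP (f := k) (g := g))//.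
by move=> t; rewrite kE gE fE big_cons.
Qed.

(* Positivity of the calculus at the function a + b (t - r)^2 - |f t|^2. *)
Lemma calculus_norm_le f (a b r : R) :
  (forall t, rnorm (f t) ^+ 2 <= a + b * (re_val t - r) ^+ 2) ->
  forall x, rnorm (Phi f x) ^+ 2 <=
    a * rnorm x ^+ 2 + b * rnorm (D x - r%:C *: x) ^+ 2.
Proof.
move=> hf x.
have [fJ fJE] := mkcts_ex (continuous_conj (@c f)).
have [ff ffE] := mkcts_ex (continuous_mul (@c fJ) (@c f)).
have [u1 u1E] := mkcts_ex (@continuous_cst R sp 1).
have [z zE] := mkcts_ex (@continuous_set_val R sp).
(* [y] is [t - r], [q] its square, and [w] the nonnegative function [a + b (t - r)^2 - |f t|^2]. *)
pose s1 := [:: (1, z); (- r%:C, u1)].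
have [y yE] := mkcts_ex (@continuous_lincomb _ s1 fst snd).
have [q qE] := mkcts_ex (continuous_mul (@c y) (@c y)).
pose s2 := [:: (a%:C, u1); (b%:C, q); (-1, ff)].
have [w wE] := mkcts_ex (@continuous_lincomb _ s2 fst snd).
have set_valE (t : sp) : set_val t = (re_val t)%:C.
  by apply: (spectrum_Re K_hilbert D_bounded D_sa); exact: set_valP.
have yR t : y t = (re_val t - r)%:C.
  by rewrite yE !big_cons big_nil /= zE u1E set_valE rmorphB /=; ring.
have Phiy v : Phi y v = D v - r%:C *: v.
  rewrite (calculus_sum yE) !big_cons big_nil /= addr0 scale1r scaleNr.
  by rewrite (fc_id PhiP zE) (fc_one PhiP u1E).
have wR t : w t = (a + b * (re_val t - r) ^+ 2 - rnorm (f t) ^+ 2)%:C.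
  rewrite wE !big_cons big_nil /= u1E qE ffE fJE yR [_^* * _]mulrC mul_conj_rnorm.
  by rewrite !(rmorphB, rmorphD, rmorphM) /=; ring.
have w0 t : 0 <= a + b * (re_val t - r) ^+ 2 - rnorm (f t) ^+ 2 by rewrite subr_ge0.
have [k kE] := calculus_ge0 w0 wR.
have : 0 <= rip (Phi w x) x by rewrite /re_ip kE -/(re_ip ip _ _) ripxx// sqr_ge0.
rewrite (calculus_sum wE) !big_cons big_nil /= addr0 scaleN1r.
rewrite !ripDl ripNl !ripZl (fc_one PhiP u1E) ripxx//.
rewrite (fc_mul PhiP ffE) (fc_mul PhiP qE).
rewrite [rip (Phi fJ _) _](_ : _ = rip (Phi f x) (Phi f x)); last first.
  by rewrite /re_ip ipC -(fc_conj PhiP fJE) -ipC.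
rewrite [rip (Phi y _) _](_ : _ = rip (Phi y x) (Phi y x)); last first.
  rewrite /re_ip (fc_conj PhiP (h := y))// => t.
  by rewrite yR; exact: esym (conjc_real _).
rewrite !ripxx// Phiy; lra.
Qed.

Lemma calculus_norm_le_cst f (B : R) : 0 <= B -> (forall t, rnorm (f t) <= B) ->
  forall x, rnorm (Phi f x) <= B * rnorm x.
Proof.
move=> B0 hB x; rewrite -(ler_pXn2r (isT : (0 < 2)%N)) ?nnegrE ?mulr_ge0 ?rnorm_ge0//.
have := @calculus_norm_le f (B ^+ 2) 0 0; rewrite exprMn => /(_ _ x).
rewrite mul0r addr0; apply => t; rewrite mul0r addr0.
by rewrite ler_pXn2r ?nnegrE ?rnorm_ge0.
Qed.

Lemma calculus_dist_le f g (B : R) : 0 <= B ->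
  (forall t, rnorm (f t - g t) <= B) ->
  forall x, rnorm (Phi f x - Phi g x) <= B * rnorm x.
Proof.
move=> B0 hB x; pose s : seq (R[i] * C_sp) := [:: (1, f); (-1, g)].
have [h hE] := mkcts_ex (@continuous_lincomb _ s fst snd).
have := calculus_sum hE x; rewrite !big_cons big_nil /= addr0 scale1r scaleN1r => <-.
apply: calculus_norm_le_cst => // t.
by rewrite hE !big_cons big_nil /= addr0 mul1r mulN1r.
Qed.

End CalculusConsequences.

(** * Numerical ranges of 2x2 matrices *)

Lemma big_ord2 (V : nmodType) (F : 'I_2 -> V) : \sum_(i < 2) F i = F 0 + F 1.
Proof.
rewrite !big_ord_recl big_ord0 addr0; congr (_ + F _); exact: val_inj.
Qed.

Lemma ord2P (i : 'I_2) : i = 0 \/ i = 1.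
Proof. by case: i => -[|[|//]] h; [left|right]; apply: val_inj. Qed.

Section MatrixNumericalRange.
Variables (R : realType) (A : 'M[R[i]]_2).

(** The trace of [A g]. *)
Definition mxform (g : 'I_2 -> 'I_2 -> R[i]) : R[i] := \sum_i \sum_j A i j * g j i.

Lemma mx_numrange_cone (y : 'I_2 -> R[i]) :
  cone_over (mx_numrange A) (rnorm (y 0) ^+ 2 + rnorm (y 1) ^+ 2)
    (mxform (fun j i => y j * (y i)^*)).
Proof.
have formE (v : 'cV[R[i]]_2) :
    cvec_ip (A *m v) v = mxform (fun j i => v j 0 * (v i 0)^*).
  rewrite /cvec_ip /mxform; apply: eq_bigr => i _; rewrite mxE mulr_suml.
  by apply: eq_bigr => j _; rewrite mulrA.
have ipE (v : 'cV[R[i]]_2) :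
    cvec_ip v v = (rnorm (v 0 0) ^+ 2 + rnorm (v 1 0) ^+ 2)%:C.
  by rewrite /cvec_ip big_ord2 !mul_conj_rnorm rmorphD.
set n := _ + _; have n0 : 0 <= n by rewrite addr_ge0 ?sqr_ge0.
have unit_in (v : 'cV[R[i]]_2) : rnorm (v 0 0) ^+ 2 + rnorm (v 1 0) ^+ 2 = 1 ->
    mx_numrange A (cvec_ip (A *m v) v).
  by move=> v1; exists v => //; rewrite /ipnorm ipE v1 sqrtC1.
split=> //; have [nz|nN] := eqVneq n 0.
  (* With weight [0] the cone still asks for some point of the numerical range; the first basis
     vector provides one. *)
  exists (cvec_ip (A *m delta_mx 0 0) (delta_mx 0 0)).
    by apply: unit_in; rewrite !mxE /= rnorm1 rnorm0 expr1n expr0n addr0.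
  rewrite nz mul0r.
  have y0 i : y i = 0.
    apply/eqP; rewrite -rnorm_eq0 -sqrf_eq0.
    move: nz; rewrite /n; have := sqr_ge0 (rnorm (y 0)); have := sqr_ge0 (rnorm (y 1)).
    by case: (ord2P i) => -> ? ? ?; apply/eqP; lra.
  by rewrite /mxform big1// => i _; rewrite big1// => j _; rewrite y0 mul0r mulr0.
pose s := (Num.sqrt n)^-1.
have ss : s ^+ 2 * n = 1 by rewrite exprVn sqr_sqrtr// mulVf.
have s0 : 0 <= s by rewrite invr_ge0 sqrtr_ge0.
pose v : 'cV[R[i]]_2 := \col_i (s%:C * y i).
exists (cvec_ip (A *m v) v).
  apply: unit_in; rewrite !mxE !rnormM rnorm_real ger0_norm// !exprMn -mulrDr.
  exact: ss.
rewrite formE /mxform mulr_sumr; apply: eq_bigr => i _.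
rewrite mulr_sumr; apply: eq_bigr => j _; rewrite !mxE rmorphM/=.
have -> : (s%:C)^* = s%:C :> R[i] by exact: conjc_real.
have -> : n%:C * (A i j * (s%:C * y j * (s%:C * (y i)^*))) =
   (s%:C * s%:C * n%:C) * (A i j * (y j * (y i)^*)) by ring.
by rewrite -!rmorphM -expr2 ss mul1r.
Qed.

End MatrixNumericalRange.

Section Gram.
Variables (R : realType) (K : completeNormedModType R[i]).
Variable ip : {dot K for Num.conj}.
Hypothesis K_hilbert : hilbert_norm ip.

(* Gram-Schmidt: the Gram matrix of v 0, v 1 is y y^* + c^2 e e^* with
   y = (|v 0|, <v 1, v 0> / |v 0|) and e = (0, 1). *)
Lemma gram_cone (A : 'M[R[i]]_2) (C : set R[i]) (v : 'I_2 -> K) :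
  @convex_set R[i] R[i]^o C -> mx_numrange A `<=` C ->
  cone_over C (rnorm (v 0) ^+ 2 + rnorm (v 1) ^+ 2)
    (mxform A (fun j i => ip (v j) (v i))).
Proof.
move=> cC AC.
have inC y : cone_over C (rnorm (y 0) ^+ 2 + rnorm (y 1) ^+ 2)
    (mxform A (fun j i => y j * (y i)^*)).
  have [n0 [w Aw wE]] := mx_numrange_cone A y.
  by split=> //; exists w => //; exact: AC.
pose vec (a b : R[i]) (i : 'I_2) := if i == 0 then a else b.
have rJ (r : R) : (r%:C)^* = r%:C :> R[i] by exact: conjc_real.
(* Here one cannot divide by [|v 0|], but the Gram matrix already has rank at most one, with vector
   [(0, |v 1|)]. *)
have [v0|v0] := eqVneq (v 0) 0.
  have := inC (vec 0 (rnorm (v 1))%:C); rewrite /vec /=.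
  rewrite v0 !rnorm0 rnorm_real ger0_norm ?rnorm_ge0//.
  congr (cone_over _ _ _); rewrite /mxform !big_ord2 /= v0 conjC0 ?rJ.
  rewrite !ip0l ip0r ip_rnorm// expr2 rmorphM.
  by rewrite !mul0r !mulr0 !add0r.
pose a := rnorm (v 0); have a0 : 0 < a by rewrite rnorm_gt0.
have aC : a%:C != 0 :> R[i] by rewrite -rnorm_eq0 rnorm_real gt_eqF// normr_gt0 gt_eqF.
pose b := ip (v 1) (v 0) / a%:C.
(* The component of [v 1] orthogonal to [v 0]. *)
pose w := v 1 - (b / a%:C) *: v 0; pose c := rnorm w.
have v00 : ip (v 0) (v 0) = a%:C * a%:C by rewrite ip_rnorm// expr2 rmorphM.
have v10 : ip (v 1) (v 0) = a%:C * b by rewrite /b; field.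
have v01 : ip (v 0) (v 1) = a%:C * b^* by rewrite ipC v10 rmorphM/= rJ.
have w0 : ip w (v 0) = 0 by rewrite /w ipDl ipNl ipZl v00 v10; field.
have v11 : ip (v 1) (v 1) = b * b^* + c%:C * c%:C.
  have <- : ip w w = c%:C * c%:C by rewrite ip_rnorm// expr2 rmorphM.
  rewrite {2}/w ipDr ipNr ipZr w0 mulr0 oppr0 addr0 /w ipDl ipNl ipZl v01.
  by field.
have := cone_overD cC (inC (vec a%:C b)) (inC (vec 0 c%:C)); rewrite /vec /=.
congr (cone_over _ _ _).
  rewrite rnorm0 !rnorm_real !ger0_norm ?(ltW a0)// ?rnorm_ge0// expr0n add0r -addrA.
  congr (_ + _); apply: complexI.
  by rewrite -(ip_rnorm K_hilbert) v11 rmorphD/= -mul_conj_rnorm [c ^+ 2]expr2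
    (rmorphM (real_complex R)).
rewrite /mxform !big_ord2 /= v00 v01 v10 v11 conjC0 ?rJ.
ring.
Qed.

End Gram.

(** * The numerical range of the block operator *)

(** Applied to the pairs of indices, to get one radius for the four entries of [f]. *)
Lemma common_radius (R : realType) (I : eqType) (r : seq I) (P : I -> R -> Prop) :
  (forall i d d', d' <= d -> P i d -> P i d') ->
  (forall i, exists2 d : R, 0 < d & P i d) ->
  exists2 d : R, 0 < d & forall i, i \in r -> P i d.
Proof.
move=> Pmon hP; elim: r => [|i r [d d0 hd]]; first by exists 1.
have [d' d'0 hd'] := hP i; exists (Num.min d d'); first by rewrite lt_min d0.
move=> j; rewrite inE => /orP[/eqP ->|jr].
  by apply: Pmon hd'; rewrite ge_min lexx orbT.
by apply: Pmon (hd j jr); rewrite ge_min lexx.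
Qed.

Section BlockOperator.
Variables (R : realType) (K : completeNormedModType R[i]).
Variable ip : {dot K for Num.conj}.
Hypothesis K_hilbert : hilbert_norm ip.
Hypothesis K_neq0 : exists x : K, x != 0.
Variables (D : K -> K) (D_bounded : bounded_operator D).
Hypothesis D_sa : self_adjoint ip D.
Local Notation sp := (spectrum D).
Local Notation C_sp := (continuousType sp R[i]).
Local Notation Phi := (cfc ip (D := D)).
Variable f : 'M[C_sp]_2.
Implicit Types (u : K * K) (t : sp).

Let PhiP : is_functional_calculus ip Phi := cfcP K_hilbert K_neq0 D_bounded D_sa.
Let Phi_linear g : linear (Phi g) := (fc_bounded PhiP g).1.

Definition coord u (i : 'I_2) : K := if i == 0 then u.1 else u.2.

Lemma dsum_ip_coord (v u : K * K) : dsum_ip ip v u = \sum_i ip (coord v i) (coord u i).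
Proof. by rewrite big_ord2. Qed.

Lemma mx_cfc_coord u i : coord (mx_cfc ip f u) i = \sum_j Phi (f i j) (coord u j).
Proof.
by rewrite big_ord2; case: (ord2P i) => ->; rewrite /mx_cfc /block_operator !mxE.
Qed.

Lemma dsum_ip_rnorm u :
  dsum_ip ip u u = (rnorm (coord u 0) ^+ 2 + rnorm (coord u 1) ^+ 2)%:C.
Proof. by rewrite dsum_ip_coord big_ord2 !ip_rnorm// rmorphD. Qed.

Lemma dsum_unit u : ipnorm (dsum_ip ip) u = 1 <->
  rnorm (coord u 0) ^+ 2 + rnorm (coord u 1) ^+ 2 = 1.
Proof.
split=> h; last by rewrite /ipnorm dsum_ip_rnorm h sqrtC1.
apply: complexI; rewrite -dsum_ip_rnorm -[LHS]sqrtCK.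
by rewrite -/(ipnorm (dsum_ip ip) u) h expr1n.
Qed.

Lemma block_numrange_convex :
  @convex_set R[i] R[i]^o (numrange (dsum_ip ip) (mx_cfc ip f)).
Proof.
apply: toeplitz_hausdorff.
- by move=> x y z; rewrite /dsum_ip /= !ipDl addrACA.
- by move=> a x z; rewrite /dsum_ip /= !ipZl mulrDr.
- by move=> x y; rewrite /dsum_ip rmorphD /= -!ipC.
- move=> [x y] xy0; rewrite dsum_ip_rnorm /coord /= ltcR.
  have [x0|x0] := eqVneq x 0.
    have y0 : y != 0 by apply: contra xy0 => /eqP ->; rewrite x0.
    by rewrite x0 rnorm0 expr0n add0r exprn_gt0// rnorm_gt0.
  by rewrite ltr_pwDl ?sqr_ge0// exprn_gt0// rnorm_gt0.
- move=> a [x1 x2] [y1 y2]; rewrite /mx_cfc /block_operator !mxE /=.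
  congr pair; rewrite !Phi_linear /=; rewrite scalerDr -!addrA; congr (_ + _);
    by rewrite addrCA.
Qed.

(** [calculus_norm_le] applies to [h = g - g t] with majorant [(e / 2)^2 + c^2 (s - t)^2]: within
    [r] of [t] the first term suffices by continuity, and beyond it
    [|h| <= 2 B = c r <= c |s - t|]. *)
Lemma cfc_approx_eigenvector (g : C_sp) t (e : R) : 0 < e ->
  exists2 d : R, 0 < d & forall x, rnorm x = 1 ->
    rnorm (D x - set_val t *: x) < d -> rnorm (Phi g x - g t *: x) < e.
Proof.
move=> e0; have cg : continuous g by exact: cts_fun.
have [B B0 hB] := spectrum_continuous_bounded K_hilbert K_neq0 D_bounded D_sa cg.
have [r r0 hr] := (continuous_rnormP g).1 cg t (e / 2) (divr_gt0 e0 (ltr0n _ 2)).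
have [c c0 cr] : exists2 c : R, 0 < c & c * r = 2 * B.
  by exists (2 * B / r); [rewrite divr_gt0// mulr_gt0|rewrite mulfVK// gt_eqF].
(* This keeps the second term of the bound below [(e / 2)^2], hence the total below [e^2 / 2]. *)
exists (e / 2 / c); first by rewrite divr_gt0// divr_gt0.
move=> x x1 xd.
have tE : set_val t = (re_val t)%:C.
  by apply: (spectrum_Re K_hilbert D_bounded D_sa); exact: set_valP.
have [u1 u1E] := mkcts_ex (@continuous_cst R sp 1).
pose s : seq (R[i] * C_sp) := [:: (1, g); (- g t, u1)].
have [h hE] := mkcts_ex (@continuous_lincomb _ _ _ _ s fst snd).
have := calculus_sum PhiP hE x; rewrite !big_cons big_nil /= addr0 scale1r scaleNr.
rewrite (fc_one PhiP u1E) => <-.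
have hh v : h v = g v - g t by rewrite hE !big_cons big_nil /= u1E mul1r mulr1 addr0.
have := @calculus_norm_le _ _ _ K_hilbert _ D_bounded D_sa _ PhiP h ((e / 2) ^+ 2)
  (c ^+ 2) (re_val t).
move=> /(_ _ x); rewrite x1 -tE => hle.
have {}hle : rnorm (Phi h x) ^+ 2 <= (e / 2) ^+ 2 * 1 ^+ 2 + c ^+ 2 * rnorm (D x -
  set_val t *: x) ^+ 2.
  apply: hle => v; rewrite hh.
  have [near|far] := ltrP (rnorm (set_val v - set_val t)) r.
    have := hr v near => hgv; apply: ler_wpDr; first by rewrite mulr_ge0 ?sqr_ge0.
    by rewrite ler_pXn2r ?nnegrE ?rnorm_ge0 ?divr_ge0 ?(ltW e0)// ltW.
  apply: ler_wpDl; first exact: sqr_ge0.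
  rewrite -exprMn -(real_normK (num_real (c * _))).
  rewrite ler_pXn2r ?nnegrE ?rnorm_ge0// normrM gtr0_norm//.
  have vt : rnorm (set_val v - set_val t) = `|re_val v - re_val t|.
    have -> : set_val v = (re_val v)%:C.
      by apply: (spectrum_Re K_hilbert D_bounded D_sa); exact: set_valP.
    by rewrite tE -rmorphB rnorm_real.
  rewrite -vt; apply: (@le_trans _ _ (2 * B)).
    have := rnormD (g v) (- g t); rewrite rnormN.
    by have := hB v; have := hB t; lra.
  by rewrite -cr ler_pM2l.
rewrite -(ltr_pXn2r (isT : (0 < 2)%N)) ?nnegrE ?rnorm_ge0 ?(ltW e0)//.
apply: le_lt_trans hle _; rewrite expr1n mulr1 -exprMn.
have : (c * rnorm (D x - set_val t *: x)) ^+ 2 < (e / 2) ^+ 2.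
  rewrite ltr_pXn2r ?nnegrE ?mulr_ge0 ?rnorm_ge0 ?(ltW c0) ?(ltW e0)//.
  by rewrite mulrC -ltr_pdivlMr.
have e2 : 0 < e ^+ 2 by rewrite exprn_gt0.
lra.
Qed.

Lemma mx_numrange_in_closure t :
  mx_numrange (mx_at f t) `<=` closure (numrange (dsum_ip ip) (mx_cfc ip f)).
Proof.
move=> z [v v1 ->]; apply/closure_rnormP => e e0.
(* Four entries contribute at most [e / 5] each, which stays strictly below [e]. *)
have e5 : 0 < e / 5 by rewrite divr_gt0.
pose P (ij : 'I_2 * 'I_2) (d : R) := forall x, rnorm x = 1 ->
  rnorm (D x - set_val t *: x) < d ->
  rnorm (Phi (f ij.1 ij.2) x - f ij.1 ij.2 t *: x) < e / 5.
have [d d0 hd] : exists2 d : R, 0 < d & forall ij, ij \in enum {: 'I_2 * 'I_2} -> P ij d.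
  apply: common_radius => [ij d d' dd' h x x1 xd|ij].
    by apply: h => //; apply: lt_le_trans dd'.
  exact: cfc_approx_eigenvector.
have [x x1 xd] := spectrum_approx_eigenvector K_hilbert D_bounded D_sa (set_valP t) d0.
have {}hd i j : rnorm (Phi (f i j) x - f i j t *: x) < e / 5.
  by apply: (hd (i, j)) => //; rewrite mem_enum.
have vv : rnorm (v 0 0) ^+ 2 + rnorm (v 1 0) ^+ 2 = 1.
  apply: complexI; rewrite [RHS]rmorph1 rmorphD/= -!mul_conj_rnorm.
  have : cvec_ip v v = 1 by rewrite -[LHS]sqrtCK -/(ipnorm (@cvec_ip R 2) v) v1 expr1n.
  by rewrite /cvec_ip big_ord2.
have vi i : rnorm (v i 0) <= 1.
  rewrite -(ler_pXn2r (isT : (0 < 2)%N)) ?nnegrE ?rnorm_ge0// expr1n -vv.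
  by case: (ord2P i) => ->; rewrite (lerDl, lerDr) sqr_ge0.
pose u : K * K := (v 0 0 *: x, v 1 0 *: x).
have uE i : coord u i = v i 0 *: x by case: (ord2P i) => ->.
exists (dsum_ip ip (mx_cfc ip f u) u).
  exists u => //; apply/dsum_unit.
  by rewrite !uE !rnormZ x1 !mulr1.
have -> : dsum_ip ip (mx_cfc ip f u) u - cvec_ip (mx_at f t *m v) v =
  \sum_i \sum_j v j 0 * (v i 0)^* * ip (Phi (f i j) x - f i j t *: x) x.
  rewrite dsum_ip_coord /cvec_ip -sumrB; apply: eq_bigr => i _.
  rewrite mx_cfc_coord mxE mulr_suml !big_ord2 !mxE !uE !ipDl !ipNl !ipZl !ipZr.
  rewrite !(linZ (Phi_linear _)) !ipZl ip_rnorm// x1 expr1n.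
  ring.
have term i j : rnorm (v j 0 * (v i 0)^* * ip (Phi (f i j) x - f i j t *: x) x) <= e / 5.
  rewrite !rnormM rnorm_conj -[leRHS]mul1r.
  apply: ler_pM; rewrite ?mulr_ge0 ?rnorm_ge0//.
    by rewrite -[leRHS]mulr1 ler_pM ?rnorm_ge0.
  by apply: le_trans (ip_le K_hilbert _ _) _; rewrite x1 mulr1 ltW.
apply: le_lt_trans (rnorm_sum _ _ _) _; rewrite big_ord2.
have row i := rnorm_sum (index_enum 'I_2) xpredT (fun j => v j 0 * (v i 0)^* * ip
  (Phi (f i j) x - f i j t *: x) x).
have := row 0; have := row 1; rewrite !big_ord2.
have := term 0 0; have := term 0 1; have := term 1 0; have := term 1 1.
lra.
Qed.

Lemma numrange_in_closure_conv :
  numrange (dsum_ip ip) (mx_cfc ip f) `<=` closure (conv_hull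
    (\bigcup_(t in [set: sp]) mx_numrange (mx_at f t))).
Proof.
set C := conv_hull _.
move=> z [u u1 ->]; apply/closure_rnormP => e e0.
have e5 : 0 < e / 5 by rewrite divr_gt0.
have uu := (dsum_unit u).1 u1.
have ui i : rnorm (coord u i) <= 1.
  rewrite -(ler_pXn2r (isT : (0 < 2)%N)) ?nnegrE ?rnorm_ge0// expr1n -uu.
  by case: (ord2P i) => ->; rewrite (lerDl, lerDr) sqr_ge0.
have [M M0 hM] := spectrum_bounded K_hilbert D_bounded D_sa.
have Ere z' : sp z' -> z' = (complex.Re z')%:C.
  exact: (@spectrum_Re _ _ _ K_hilbert _ D_bounded D_sa z').
have Ecl := @spectrum_closed _ _ _ K_hilbert _ D_bounded D_sa.
have Ene := spectrum_nonempty K_hilbert K_neq0 D_bounded D_sa.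
have [d d0 hd] : exists2 d : R, 0 < d & forall ij : 'I_2 * 'I_2,
    ij \in enum {: 'I_2 * 'I_2} -> forall s t : sp, `|re_val s - re_val t| < d ->
    rnorm (f ij.1 ij.2 s - f ij.1 ij.2 t) < e / 5.
  apply: common_radius => [ij d d' dd' h s t st|ij].
    by apply: h; apply: lt_le_trans dd'.
  have cf : continuous (f ij.1 ij.2) by exact: cts_fun.
  exact (uniform_continuity Ere hM Ecl cf e5).
have {}hd i j (s t : sp) : `|re_val s - re_val t| < d -> rnorm (f i j s - f i j t) < e / 5.
  by apply: (hd (i, j)); rewrite mem_enum.
have [n [phi [p [phi0 phi1 phid phic _]]]] := spectrum_partition Ere M0 hM Ene d0.
pose F k : C_sp := mkcts (phic k).
pose a i j k := f i j (p k).
have [S SE] : exists S : 'I_2 -> 'I_2 -> C_sp, forall i j t,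
    S i j t = \sum_k a i j k * F k t.
  have ex i j := cid (mkcts_ex (@continuous_lincomb _ _ _ _ (index_enum 'I_n) (a i j) F)).
  by exists (fun i j => projT1 (ex i j)) => i j t; case: (ex i j) => g gE; exact: gE.
have fS i j t : rnorm (f i j t - S i j t) <= e / 5.
  rewrite rdistC SE.
  under eq_bigr do rewrite mulrC.
  apply: (partition_approx (phi := fun k => phi k (re_val t)) (u := a i j)) => // k.
  by move=> h; apply/ltW/hd; rewrite distrC; exact: phid.
have hk k := calculus_ge0 PhiP (f := F k) (fun t => phi0 k (re_val t)) (fun t => erefl).
(* A square root of [phi k] applied to the coordinates of [u]; the Gram matrix of [v k] is the [G_k]
   of the overview. *)
pose v k i := Phi (projT1 (cid (hk k))) (coord u i).
have vE k i j : ip (v k j) (v k i) = ip (Phi (F k) (coord u j)) (coord u i).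
  by rewrite /v; case: cid => g /= ->.
pose w := \sum_k mxform (mx_at f (p k)) (fun j i => ip (v k j) (v k i)).
(* The cone lemma yields a point of some numerical range even from the zero vector. *)
have C0 : C !=set0.
  have [z0 z0E] := Ene.
  have [_ [w0 w0E _]] := mx_numrange_cone (mx_at f (exist _ z0 (mem_set z0E))) (fun=> 0).
  by exists w0 => B [_]; apply; exists (exist _ z0 (mem_set z0E)).
have : cone_over C (\sum_k (rnorm (v k 0) ^+ 2 + rnorm (v k 1) ^+ 2)) w.
  apply: cone_over_sum => //; first exact: conv_hull_convex.
  move=> k; apply: gram_cone => //; first exact: conv_hull_convex.
  by move=> y hy B [_]; apply; exists (p k).
have sum1 x : \sum_k Phi (F k) x = x.
  have [h hE] := mkcts_ex (@continuous_lincomb _ _ _ _ (index_enum 'I_n) (fun=> 1) F).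
  have := calculus_sum PhiP hE x.
  under eq_bigr do rewrite scale1r.
  move=> <-; apply: (fc_one PhiP) => t; rewrite hE.
  under eq_bigr do rewrite mul1r.
  by rewrite -(rmorph_sum (real_complex R)) phi1.
(* The traces add up to the squared norm of [u], because the [phi k] sum to [1] and the calculus
   sends [1] to the identity. *)
have -> : \sum_k (rnorm (v k 0) ^+ 2 + rnorm (v k 1) ^+ 2) = 1.
  apply: complexI; rewrite (rmorph_sum (real_complex R)) [RHS]rmorph1 -(rmorph1
    (real_complex R)) -uu.
  under eq_bigr do rewrite (rmorphD (real_complex R)) /= -!(ip_rnorm K_hilbert) !vE.
  rewrite big_split/= (rmorphD (real_complex R)) /= -!(ip_rnorm K_hilbert).
  have ipsum (y z' : K) : \sum_k ip (Phi (F k) y) z' = ip y z'.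
    rewrite -[in RHS](sum1 y).
    by rewrite (big_morph (fun x => ip x z') (fun x y => ipDl ip x y z') (ip0l ip z')).
  by rewrite !ipsum.
case=> _ [y Cy wy]; exists w; first by rewrite wy rmorph1 mul1r.
have -> : w - dsum_ip ip (mx_cfc ip f u) u =
    \sum_i \sum_j ip (Phi (S i j) (coord u j) - Phi (f i j) (coord u j)) (coord u i).
  rewrite dsum_ip_coord /w /mxform exchange_big /= -sumrB; apply: eq_bigr => i _.
  rewrite exchange_big /= mx_cfc_coord.
  rewrite (big_morph (fun x => ip x (coord u i)) (fun x y => ipDl ip x y _) (ip0l ip _)).
  rewrite -sumrB; apply: eq_bigr => j _; rewrite ipDl ipNl; congr (_ - _).
  rewrite (calculus_sum PhiP (SE i j)).
  rewrite (big_morph (fun x => ip x (coord u i)) (fun x y => ipDl ip x y _) (ip0l ip _)).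
  by apply: eq_bigr => k _; rewrite ipZl vE mxE.
have term i j : rnorm (ip (Phi (S i j) (coord u j) - Phi (f i j) (coord u j))
  (coord u i)) <= e / 5.
  apply: le_trans (ip_le K_hilbert _ _) _; rewrite -[leRHS]mulr1.
  apply: ler_pM; rewrite ?rnorm_ge0//.
  have h := @calculus_dist_le _ _ _ K_hilbert _ D_bounded D_sa _ PhiP (S i j) (f i
    j) (e / 5) (ltW e5).
  apply: le_trans (h _ _) _; first by move=> t; rewrite rdistC.
  by rewrite -[leRHS]mulr1 ler_pM2l.
apply: le_lt_trans (rnorm_sum _ _ _) _; rewrite big_ord2.
have row i := rnorm_sum (index_enum 'I_2) xpredT (fun j => ip (Phi (S i j) (coord u
  j) - Phi (f i j) (coord u j)) (coord u i)).
have := row 0; have := row 1; rewrite !big_ord2.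
have := term 0 0; have := term 0 1; have := term 1 0; have := term 1 1.
lra.
Qed.

Lemma closure_block_numrange :
  closure (numrange (dsum_ip ip) (mx_cfc ip f)) =
  closure (conv_hull (\bigcup_(t in [set: sp]) mx_numrange (mx_at f t))).
Proof.
have clcl (A B : set R[i]) : A `<=` closure B -> closure A `<=` closure B.
  move=> AB z /closure_rnormP hz; apply/closure_rnormP => e e0.
  have e2 : 0 < e / 2 by rewrite divr_gt0.
  have [y /AB/closure_rnormP/(_ _ e2)[x Bx xy] yz] := hz _ e2.
  by exists x => //; have := rdistD y x z; lra.
rewrite eqEsubset; split; apply: clcl.
  exact: numrange_in_closure_conv.
(* The hull is the smallest convex set, so it suffices that the closure of the block range is convex
   and contains every matrix range. *)
move=> z; apply; split; first exact: closure_convex block_numrange_convex.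
by move=> y [t _]; exact: mx_numrange_in_closure.
Qed.

End BlockOperator.

Theorem theorem4p7 (R : realType) (K : completeNormedModType R[i])
    (ip : {dot K for Num.conj}) (K_hilbert : hilbert_norm ip)
    (K_neq0 : exists x : K, x != 0)
    (D : K -> K) (D_bounded : bounded_operator D)
    (D_self_adjoint : self_adjoint ip D)
    (f : 'M[continuousType (spectrum D) R[i]]_2) :
  closure (numrange (dsum_ip ip) (mx_cfc ip f)) =
  closure (conv_hull
    (\bigcup_(t in [set: spectrum D]) mx_numrange (mx_at f t))).
Proof. exact: closure_block_numrange. Qed.
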